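(* Let $G$ be a (torsionfree) discrete countable group such that every non-zero element of $\mathbb Z G$ acts without kernel on $\ell^2 G$. Assume that $\beta_1^{(2)}(G)\neq 0$. Let $F$ be a finite subset of $G$. Then there exists a non-trivial element $g \in G$ such that $g$ is free from each element of $F$. In particular, $G$ contains a copy of the free group $F_2$ of rank $2$.
   Context: $\mathbb Z G$ acts on the Hilbert space $\ell^2 G$ via the linear extension of the left regular representation; ''without kernel'' means injectively. An element $g$ is free from an element $f$ if the canonical homomorphism $\langle g\rangle\ast\langle f\rangle\to\langle g,f\rangle\subset G$ is an isomorphism. $\beta_1^{(2)}(G)=\dim_{LG}H_1(G;LG)$ is the first $\ell^2$-Betti number, where $LG$ is the group von Neumann algebra and $\dim_{LG}$ is Lück's dimension function. *)

(* Defs.v *)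
From HB Require Import structures.
From mathcomp Require Import all_boot all_order all_algebra finmap complex.
From mathcomp Require Import boolp classical_sets functions cardinality fsbigop.
From mathcomp Require Import reals ereal esum.
(* the notations of monalg clash with those of MathComp-Analysis *)
From mathcomp.multinomials Require Import -(notations) monalg.
From mathcomp Require Import ring lra.

Set Implicit Arguments.
Unset Strict Implicit.
Unset Printing Implicit Defensive.

Import Order.TTheory GRing.Theory Num.Theory.

Local Open Scope classical_set_scope.
Local Open Scope ring_scope.
Local Open Scope quotient_scope.

Section L2.
Variables (R : realType) (G : choiceType).
Implicit Types f g : G -> R[i].

Definition abs2 (z : R[i]) : R := complex.Re z ^+ 2 + complex.Im z ^+ 2.

Definition esqnorm f : \bar R := \esum_(x in [set: G]) (abs2 (f x))%:E.

Definition square_summable : {pred G -> R[i]} :=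
  fun f => `[< (esqnorm f < +oo)%E >].

Lemma abs2_ge0 z : 0 <= abs2 z.
Proof. by rewrite /abs2 addr_ge0 ?sqr_ge0. Qed.

Lemma abs2M y z : abs2 (y * z) = abs2 y * abs2 z.
Proof. by case: y z => [a b] [c d]; rewrite /abs2 /=; ring. Qed.

Lemma abs2N z : abs2 (- z) = abs2 z.
Proof. by case: z => a b; rewrite /abs2 /= !sqrrN. Qed.

Lemma abs2D y z : abs2 (y + z) <= 2 * (abs2 y + abs2 z).
Proof.
case: y z => [a b] [c d]; rewrite /abs2 /=.
have := sqr_ge0 (a - c); have := sqr_ge0 (b - d); nra.
Qed.

Lemma esqnorm_ge0 f : (0 <= esqnorm f)%E.
Proof. by apply: esum_ge0 => x _; rewrite lee_fin abs2_ge0. Qed.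

Lemma esumZn (a : G -> R) n : (forall x, 0 <= a x) ->
  (\esum_(x in [set: G]) (n%:R * a x)%:E
   = n%:R%:E * \esum_(x in [set: G]) (a x)%:E)%E.
Proof.
move=> a0; elim: n => [|n IHn].
  by rewrite mul0e; apply: esum1 => x _; rewrite mul0r.
rewrite -natr1 EFinD ge0_muleDl ?lee_fin ?ler0n// mul1e -IHn -esumD.
- by apply: eq_esum => x _; rewrite mulrDl mul1r.
- by move=> x _; rewrite lee_fin mulr_ge0.
- by move=> x _; rewrite lee_fin.
Qed.

Lemma esqnormZ_le c f : exists n : nat, (esqnorm (c *: f) <= n%:R%:E * esqnorm f)%E.
Proof.
have [n cn] : exists n : nat, abs2 c <= n%:R.
  by exists (Num.bound (abs2 c)); rewrite ltW// archi_boundP// abs2_ge0.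
exists n; rewrite -esumZn; last by move=> x; exact: abs2_ge0.
apply: le_esum => x _; rewrite lee_fin /= abs2M.
by apply: ler_wpM2r => //; exact: abs2_ge0.
Qed.

Lemma esqnormD_le f g :
  (esqnorm (f + g)%R <= 2%:R%:E * (esqnorm f + esqnorm g))%E.
Proof.
rewrite /esqnorm -esumD; try by move=> x _; rewrite lee_fin abs2_ge0.
under [X in (_ <= _ * X)%E]eq_esum => x _ do rewrite -EFinD.
rewrite -esumZn; last by move=> x; rewrite addr_ge0 ?abs2_ge0.
by apply: le_esum => x _; rewrite lee_fin; exact: abs2D.
Qed.

Lemma square_summable_submod : GRing.submod_closed square_summable.
Proof.
split=> [|c f g /asboolP fG /asboolP gG]; apply/asboolP.
  rewrite /esqnorm esum1 ?ltry// => x _.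
  by rewrite /abs2 /= expr0n /= addr0.
apply: le_lt_trans (esqnormD_le _ _) _.
have [n cn] := esqnormZ_le c f.
rewrite lte_mul_pinfty ?lee_fin// lte_add_pinfty//.
apply: le_lt_trans cn _; rewrite lte_mul_pinfty ?lee_fin ?ler0n//.
Qed.
HB.instance Definition _ :=
  GRing.isSubmodClosed.Build R[i] (G -> R[i]) square_summable
    square_summable_submod.

Record l2 := L2 { l2_fun :> G -> R[i]; _ : l2_fun \in square_summable }.
HB.instance Definition _ := [isSub for l2_fun].
HB.instance Definition _ := [Choice of l2 by <:].
HB.instance Definition _ := [SubChoice_isSubLmodule of l2 by <:].

Definition l2norm (f : l2) : R := Num.sqrt (fine (esqnorm f)).

End L2.

Section BoundedOperators.
Variables (R : realType) (G : choiceType).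
Local Notation l2 := (l2 R G).
Implicit Types (f g : l2) (S T : l2 -> l2).

Definition bounded_linear : {pred l2 -> l2} :=
  fun T => `[< linear T /\
               exists C : R, forall f, l2norm (T f) <= C * l2norm f >].

Lemma esqnormE f : esqnorm f = ((l2norm f) ^+ 2)%:E.
Proof.
have fin : esqnorm f \is a fin_num.
  by rewrite ge0_fin_numE ?esqnorm_ge0//; have /asboolP := valP f.
by rewrite sqr_sqrtr ?fine_ge0 ?esqnorm_ge0// fineK.
Qed.

Lemma l2norm_ge0 f : 0 <= l2norm f. Proof. exact: sqrtr_ge0. Qed.

Lemma l2normD_le f g : l2norm (f + g) <= 2 * (l2norm f + l2norm g).
Proof.
rewrite -(@ler_pXn2r _ 2) ?nnegrE ?mulr_ge0 ?addr_ge0 ?l2norm_ge0//.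
rewrite -lee_fin -esqnormE; apply: le_trans (esqnormD_le _ _) _.
rewrite !esqnormE -EFinD -EFinM lee_fin.
by have := l2norm_ge0 f; have := l2norm_ge0 g; nra.
Qed.

Lemma l2normN f : l2norm (- f) = l2norm f.
Proof.
rewrite /l2norm; congr (Num.sqrt (fine _)); apply: eq_esum => x _.
by congr _%:E; rewrite -[RHS]abs2N.
Qed.

Lemma bounded_linear_zmod : zmod_closed bounded_linear.
Proof.
split=> [|S T /asboolP[linS [C SC]] /asboolP[linT [D TD]]]; apply/asboolP.
  split=> [a f g|]; first by rewrite /= scaler0 addr0.
  exists 0 => f; rewrite mul0r /l2norm /esqnorm esum1 ?sqrtr0// => x _.
  by rewrite /abs2 /= expr0n /= addr0.
split=> [a f g|].
  rewrite -[LHS]/(S (a *: f + g) - T (a *: f + g)) linS linT.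
  by rewrite opprD addrACA -scalerBr.
exists (2 * (C + D)) => f; apply: le_trans (l2normD_le _ _) _.
by rewrite l2normN -mulrA ler_pM2l// mulrDl lerD.
Qed.
HB.instance Definition _ :=
  GRing.isZmodClosed.Build (l2 -> l2) bounded_linear bounded_linear_zmod.

Record bounded_op :=
  BoundedOp { bounded_op_fun :> l2 -> l2; _ : bounded_op_fun \in bounded_linear }.
HB.instance Definition _ := [isSub for bounded_op_fun].
HB.instance Definition _ := [Choice of bounded_op by <:].
HB.instance Definition _ := [SubChoice_isSubZmodule of bounded_op by <:].

Lemma bounded_opP (A B : bounded_op) : A =1 B -> A = B.
Proof. by move=> AB; apply/val_inj/funext. Qed.

Lemma bounded_op_linear (A : bounded_op) : linear A.
Proof. by case: A => T /= /asboolP[]. Qed.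

Lemma bounded_opD (A : bounded_op) : {morph A : f g / f + g}.
Proof. by move=> f g; have := bounded_op_linear A 1 f g; rewrite !scale1r. Qed.

Lemma bounded_op_comp_subproof (A B : bounded_op) :
  (A : l2 -> l2) \o B \in bounded_linear.
Proof.
case: A B => [S /= /asboolP[linS [C SC]]] [T /= /asboolP[linT [D TD]]].
apply/asboolP; split=> [a f g|]; first by rewrite /= linT linS.
exists (`|C| * D) => f; apply: le_trans (SC _) _.
rewrite -mulrA; apply: (@le_trans _ _ (`|C| * l2norm (T f))).
  by rewrite ler_wpM2r ?l2norm_ge0// ler_norm.
by rewrite ler_wpM2l.
Qed.

Lemma bounded_op_id_subproof : (@idfun l2) \in bounded_linear.
Proof.
by apply/asboolP; split=> [//|]; exists 1 => f; rewrite mul1r.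
Qed.

Definition bounded_op_id := BoundedOp bounded_op_id_subproof.
Definition bounded_op_comp A B := BoundedOp (bounded_op_comp_subproof A B).

End BoundedOperators.

Section GroupVonNeumannAlgebra.
Variables (R : realType) (G : groupType).
Local Notation l2 := (l2 R G).
Local Notation bounded_op := (bounded_op R G).

Lemma delta_subproof (g : G) :
  (fun x : G => (x == g)%:R : R[i]) \in @square_summable R G.
Proof.
apply/asboolP; rewrite /esqnorm (esumID [set g]); last first.
  by move=> x _; rewrite lee_fin abs2_ge0.
rewrite setTI esum_set1 ?lee_fin ?abs2_ge0//.
rewrite [X in (_ + X)%E]esum1 ?adde0 ?ltry// => x [_ /= xg].
by case: eqP => // _; rewrite /abs2 /= expr0n /= addr0.
Qed.
Definition delta g : l2 := L2 (delta_subproof g).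

Lemma bounded_op_id_neq0 : bounded_op_id R G != 0.
Proof.
apply/eqP => /(congr1 (fun A : bounded_op => A (delta 1%g) 1%g)) /= /eqP.
by rewrite eqxx oner_eq0.
Qed.

Fact bounded_op_mulA : associative (@bounded_op_comp R G).
Proof. by move=> A B C; apply: bounded_opP. Qed.
Fact bounded_op_mul1 : left_id (bounded_op_id R G) (@bounded_op_comp R G).
Proof. by move=> A; apply: bounded_opP. Qed.
Fact bounded_op_1mul : right_id (bounded_op_id R G) (@bounded_op_comp R G).
Proof. by move=> A; apply: bounded_opP. Qed.
Fact bounded_op_mulDl : left_distributive (@bounded_op_comp R G) +%R.
Proof. by move=> A B C; apply: bounded_opP. Qed.
Fact bounded_op_mulDr : right_distributive (@bounded_op_comp R G) +%R.
Proof. by move=> A B C; apply: bounded_opP => f /=; rewrite bounded_opD. Qed.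

HB.instance Definition _ := GRing.Zmodule_isNzRing.Build bounded_op
  bounded_op_mulA bounded_op_mul1 bounded_op_1mul bounded_op_mulDl
  bounded_op_mulDr bounded_op_id_neq0.

Definition ltrans_fun (g : G) (f : G -> R[i]) : G -> R[i] :=
  fun x => f (g^-1 * x)%g.

Lemma esqnorm_ltrans g f : esqnorm (ltrans_fun g f) = esqnorm f.
Proof.
rewrite /esqnorm (reindex_esum setT setT (fun x => g * x)%g).
  by apply: eq_esum => x _; rewrite /ltrans_fun mulKg.
split=> // [x y _ _ /mulgI//|x _].
by exists (g^-1 * x)%g => //; rewrite mulVKg.
Qed.

Lemma ltrans_subproof g (f : l2) : ltrans_fun g f \in @square_summable R G.
Proof. by apply/asboolP; rewrite esqnorm_ltrans; have /asboolP := valP f. Qed.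
Definition ltrans g (f : l2) : l2 := L2 (ltrans_subproof g f).

Lemma ltrans_bounded g : ltrans g \in @bounded_linear R G.
Proof.
apply/asboolP; split=> [a f h|]; first exact/val_inj.
by exists 1 => f; rewrite mul1r /l2norm /= esqnorm_ltrans.
Qed.
Definition left_regular g : bounded_op := BoundedOp (ltrans_bounded g).

Definition commutant (S : set bounded_op) : set bounded_op :=
  [set A | forall B, S B -> A * B = B * A].

(* LG is generated, as a von Neumann algebra, by the left regular
   representation: it is its bicommutant *)
Definition in_group_vN : {pred bounded_op} :=
  fun A => `[< commutant (commutant (range left_regular)) A >].

Lemma in_group_vN_subring : GRing.subring_closed in_group_vN.
Proof.
split=> [|A B /asboolP cA /asboolP cB|A B /asboolP cA /asboolP cB];
  apply/asboolP => C cC.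
- by rewrite mul1r mulr1.
- by rewrite mulrBl mulrBr cA// cB.
- by rewrite -mulrA cB// mulrA cA// mulrA.
Qed.
HB.instance Definition _ :=
  GRing.isSubringClosed.Build bounded_op in_group_vN in_group_vN_subring.

Record group_vN :=
  GroupVN { group_vN_op :> bounded_op; _ : group_vN_op \in in_group_vN }.
HB.instance Definition _ := [isSub for group_vN_op].
HB.instance Definition _ := [Choice of group_vN by <:].
HB.instance Definition _ := [SubChoice_isSubNzRing of group_vN by <:].

Lemma left_regular_vN g : left_regular g \in in_group_vN.
Proof. by apply/asboolP => B cB; apply/esym/cB; exists g. Qed.
Definition vN_group_elt g : group_vN := GroupVN (left_regular_vN g).

(* the trace <a delta_1, delta_1> *)
Definition vN_trace (a : group_vN) : R[i] := (a : bounded_op) (delta 1%g) 1%g.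

(* the integral group ring ZG is malg G int *)
Definition group_ring_act (a : malg G int) (f : l2) : l2 :=
  \sum_(g <- msupp a) left_regular g f *~ mcoeff g a.

End GroupVonNeumannAlgebra.

Section QuotientModule.
Variables (S : pzRingType) (M : lmodType S) (N : submodClosed M).

Definition quotmod_ker : {pred M} := N.
Fact quotmod_ker_zmod_closed : zmod_closed quotmod_ker.
Proof.
split=> [|x y xN yN]; first exact: (rpred0 N).
by rewrite -scaleN1r; apply: (rpredD (S := N)) => //; exact: (rpredZ (s := N)).
Qed.
HB.instance Definition _ := GRing.isZmodClosed.Build M quotmod_ker
  quotmod_ker_zmod_closed.

Definition quotmod := Quotient.quot quotmod_ker.
HB.instance Definition _ := GRing.Zmodule.on quotmod.
HB.instance Definition _ := EqQuotient.on quotmod.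

Definition quotmod_scale (a : S) (x : quotmod) : quotmod :=
  \pi_quotmod (a *: repr x).

Lemma quotmod_piP (x y : M) :
  reflect (\pi_quotmod x = \pi_quotmod y) (x - y \in N).
Proof.
by rewrite -[x - y \in N]/(x - y \in quotmod_ker) Quotient.idealrBE; apply: eqP.
Qed.

Lemma pi_quotmodD : {morph \pi_quotmod : x y / x + y}.
Proof. by move=> x y; rewrite raddfD. Qed.

Lemma pi_quotmodZ a (x : M) :
  quotmod_scale a (\pi_quotmod x) = \pi_quotmod (a *: x).
Proof.
apply/quotmod_piP; rewrite -scalerBr rpredZ//.
by apply/quotmod_piP; rewrite reprK.
Qed.

Fact quotmod_scaleA a b x :
  quotmod_scale a (quotmod_scale b x) = quotmod_scale (a * b) x.
Proof.
elim/quotW: x => x.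
by rewrite (pi_quotmodZ b) (pi_quotmodZ a) (pi_quotmodZ (a * b)) scalerA.
Qed.
Fact quotmod_scale1 : left_id 1 quotmod_scale.
Proof. by elim/quotW => x; rewrite pi_quotmodZ scale1r. Qed.
Fact quotmod_scaleDr : right_distributive quotmod_scale +%R.
Proof.
move=> a; elim/quotW => x; elim/quotW => y.
by rewrite -pi_quotmodD !pi_quotmodZ scalerDr pi_quotmodD.
Qed.
Fact quotmod_scaleDl x : {morph quotmod_scale^~ x : a b / a + b}.
Proof.
by elim/quotW: x => x a b; rewrite !pi_quotmodZ scalerDl pi_quotmodD.
Qed.
HB.instance Definition _ := GRing.Zmodule_isLmodule.Build S quotmod
  quotmod_scaleA quotmod_scale1 quotmod_scaleDr quotmod_scaleDl.

End QuotientModule.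

(* malg K S is the free left S-module on K *)
Section FreeModuleMap.
Variables (S : nzRingType) (K : choiceType) (M : lmodType S) (phi : K -> M).

Definition malg_lift (c : malg K S) : M :=
  \sum_(k <- msupp c) mcoeff k c *: phi k.

Lemma malg_liftE (D : {fset K}) c : (msupp c `<=` D)%fset ->
  malg_lift c = \sum_(k <- D) mcoeff k c *: phi k.
Proof.
move=> cD; rewrite /malg_lift [RHS](bigID (mem (msupp c))) /=.
rewrite [X in _ + X]big1 ?addr0; last first.
  by move=> k kc; rewrite mcoeff_outdom// scale0r.
rewrite -[RHS]big_filter; apply: perm_big; apply: uniq_perm.
- exact: fset_uniq.
- by rewrite filter_uniq// fset_uniq.
by move=> k; rewrite mem_filter andb_idr// => /(fsubsetP cD).
Qed.

Lemma malg_lift_linear : linear malg_lift.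
Proof.
move=> a c d; set D := (msupp (a *: c + d) `|` (msupp c `|` msupp d))%fset.
have sD : [/\ msupp (a *: c + d) `<=` D, msupp c `<=` D & msupp d `<=` D]%fset.
  by split; apply/fsubsetP => k kx; rewrite !inE kx ?orbT.
case: sD => s1 s2 s3.
rewrite (malg_liftE s1) (malg_liftE s2) (malg_liftE s3) scaler_sumr.
rewrite -big_split /=; apply: eq_bigr => k _.
by rewrite mcoeffD mcoeffZ scalerDl scalerA.
Qed.
HB.instance Definition _ :=
  GRing.isLinear.Build S (malg K S) M *:%R malg_lift malg_lift_linear.

End FreeModuleMap.

(* H_1(G; LG) = Tor_1^{ZG}(LG, Z), computed by the bar complex
   LG[G x G] -> LG[G] -> LG of left LG-modules; G acts on the coefficients LG
   by right multiplication *)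
Section FirstHomology.
Variables (R : realType) (G : groupType).
Local Notation LG := (group_vN R G).
Local Notation u := (@vN_group_elt R G).

Definition bar_d1 : malg G LG -> LG^o := malg_lift (fun g => u g - 1 : LG^o).
HB.instance Definition _ := GRing.Linear.on bar_d1.

Definition bar_d2 : malg (G * G)%type LG -> malg G LG :=
  malg_lift (fun gh => mkmalgU gh.2 (u gh.1) - mkmalgU (gh.1 * gh.2)%g 1
                       + mkmalgU gh.1 1).
HB.instance Definition _ := GRing.Linear.on bar_d2.

Definition is_cycle1 : {pred malg G LG} := fun c => bar_d1 c == 0.
Fact cycle1_submod : GRing.submod_closed is_cycle1.
Proof.
split=> [|a c d]; rewrite !unfold_in ?linear0// => /eqP c0 /eqP d0.
have -> : bar_d1 (a *: c + d) = a *: bar_d1 c + bar_d1 d by exact: linearP.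
by rewrite c0 d0 scaler0 addr0.
Qed.
HB.instance Definition _ :=
  GRing.isSubmodClosed.Build LG (malg G LG) is_cycle1 cycle1_submod.

Record cycle1 := Cycle1 { cycle1_val :> malg G LG; _ : cycle1_val \in is_cycle1 }.
HB.instance Definition _ := [isSub for cycle1_val].
HB.instance Definition _ := [Choice of cycle1 by <:].
HB.instance Definition _ := [SubChoice_isSubLmodule of cycle1 by <:].

Definition is_boundary1 : {pred cycle1} :=
  fun z => `[< exists c, bar_d2 c = z >].
Fact boundary1_submod : GRing.submod_closed is_boundary1.
Proof.
split=> [|a c d /asboolP[c' cc'] /asboolP[d' dd']]; apply/asboolP.
  by exists 0; rewrite linear0.
exists (a *: c' + d').
have -> : bar_d2 (a *: c' + d') = a *: bar_d2 c' + bar_d2 d' by exact: linearP.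
by rewrite cc' dd'.
Qed.
HB.instance Definition _ :=
  GRing.isSubmodClosed.Build LG cycle1 is_boundary1 boundary1_submod.

Lemma vN_group_eltM g h : u (g * h)%g = u g * u h.
Proof.
apply/val_inj/bounded_opP => f; apply/val_inj/funext => x /=.
by rewrite /ltrans_fun /= invgM mulgA.
Qed.

Lemma malg_liftU (K : choiceType) (M : lmodType LG) (phi : K -> M) k a :
  malg_lift phi (mkmalgU k a) = a *: phi k.
Proof.
rewrite (@malg_liftE _ _ _ _ [fset k]%fset) ?msuppU_le//.
by rewrite big_seq_fset1 mcoeffUU.
Qed.

Lemma bar_d1U g a : bar_d1 (mkmalgU g a) = a * (u g - 1).
Proof. exact: malg_liftU. Qed.

Lemma bar_d1_d2 c : bar_d1 (bar_d2 c) = 0.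
Proof.
rewrite /bar_d2 /malg_lift linear_sum big1// => -[g h] _ /=.
have -> a x : bar_d1 (a *: x) = a * bar_d1 x by exact: linearZ.
have -> x y z : bar_d1 (x - y + z) = bar_d1 x - bar_d1 y + bar_d1 z.
  by rewrite linearD linearB.
rewrite !bar_d1U vN_group_eltM !mul1r mulrBr mulr1.
by rewrite opprB [_ - u g + _]addrC !subrKA subrr mulr0.
Qed.

Definition H1 := quotmod is_boundary1.
HB.instance Definition _ := GRing.Lmodule.on H1.

End FirstHomology.

Section Dimension.
Variables (R : realType) (G : groupType).
Local Notation LG := (group_vN R G).

(* The submodule P of M is finitely generated projective, being isomorphic to
   the direct summand LG^n A of LG^n for the idempotent matrix A. (A linear map
   on LG^n A extends to LG^n, so it is enough to consider the latter.) *)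
Definition fg_projective (M : lmodType LG) (P : set M) n (A : 'M[LG]_n) :=
  let im_A := range (fun v : 'rV[LG]_n => v *m A) in
  A *m A = A /\ exists f : {linear 'rV[LG]_n -> M}, set_bij im_A P f.

(* The trace of an idempotent matrix is a nonnegative real number, which
   depends only on the isomorphism class of LG^n A. *)
Definition projective_dim n (A : 'M[LG]_n) : R := complex.Re (vN_trace (\tr A)).

Definition luck_dim (M : lmodType LG) : \bar R :=
  ereal_sup [set d | exists (P : set M) n (A : 'M[LG]_n),
                       fg_projective P A /\ d = (projective_dim A)%:E].

Definition l2_betti1 : \bar R := luck_dim (H1 R G).

End Dimension.

Section FreeProduct.
Variables A B : groupType.
Local Notation word := (seq (A + B)).

(* the free product of A and B is the monoid of words in A + B modulo the
   congruence generated by the relations of A and of B *)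
Inductive fp_eq : word -> word -> Prop :=
| fp_eq_refl w : fp_eq w w
| fp_eq_sym w w' : fp_eq w w' -> fp_eq w' w
| fp_eq_trans w1 w2 w3 : fp_eq w1 w2 -> fp_eq w2 w3 -> fp_eq w1 w3
| fp_eq_cat v v' w w' : fp_eq v v' -> fp_eq w w' -> fp_eq (v ++ w) (v' ++ w')
| fp_eq_inl1 : fp_eq [:: inl 1%g] [::]
| fp_eq_inr1 : fp_eq [:: inr 1%g] [::]
| fp_eq_inlM a a' : fp_eq [:: inl a; inl a'] [:: inl (a * a')%g]
| fp_eq_inrM b b' : fp_eq [:: inr b; inr b'] [:: inr (b * b')%g].

Definition fp_rel : rel word := fun v w => `[< fp_eq v w >].

Fact fp_rel_refl : reflexive fp_rel.
Proof. by move=> w; apply/asboolP; exact: fp_eq_refl. Qed.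
Fact fp_rel_sym : symmetric fp_rel.
Proof. by move=> v w; apply/asboolP/asboolP; exact: fp_eq_sym. Qed.
Fact fp_rel_trans : transitive fp_rel.
Proof.
by move=> v u w /asboolP uv /asboolP vw; apply/asboolP/(fp_eq_trans uv vw).
Qed.
Canonical fp_equiv := EquivRel fp_rel fp_rel_refl fp_rel_sym fp_rel_trans.

Definition freeprod := {eq_quot fp_rel}.
HB.instance Definition _ := Choice.on freeprod.
HB.instance Definition _ := EqQuotient.on freeprod.

Definition fp_letter_inv (x : A + B) : A + B :=
  match x with inl a => inl a^-1%g | inr b => inr b^-1%g end.
Definition fp_word_inv (w : word) : word := rev (map fp_letter_inv w).

Definition fp_one : freeprod := \pi_freeprod [::].
Definition fp_mul (x y : freeprod) : freeprod := \pi_freeprod (repr x ++ repr y).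
Definition fp_inv (x : freeprod) : freeprod := \pi_freeprod (fp_word_inv (repr x)).

Lemma fp_piP v w : reflect (\pi_freeprod v = \pi_freeprod w) `[< fp_eq v w >].
Proof.
have <- : (\pi_freeprod v == \pi_freeprod w) = `[< fp_eq v w >] by exact: eqmodE.
exact: eqP.
Qed.

Lemma fp_eq_repr w : fp_eq (repr (\pi_freeprod w)) w.
Proof. by apply/asboolP/fp_piP; rewrite reprK. Qed.

Lemma pi_fp_mul v w :
  fp_mul (\pi_freeprod v) (\pi_freeprod w) = \pi_freeprod (v ++ w).
Proof. by apply/fp_piP/asboolP/fp_eq_cat; exact: fp_eq_repr. Qed.

Lemma fp_word_inv_cat v w :
  fp_word_inv (v ++ w) = fp_word_inv w ++ fp_word_inv v.
Proof. by rewrite /fp_word_inv map_cat rev_cat. Qed.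

Lemma fp_eq_inv v w : fp_eq v w -> fp_eq (fp_word_inv v) (fp_word_inv w).
Proof.
elim=> {v w}.
- by move=> w; exact: fp_eq_refl.
- by move=> v w _; exact: fp_eq_sym.
- by move=> u v w _ uv _; exact: fp_eq_trans.
- by move=> v v' w w' _ vv' _ ww'; rewrite !fp_word_inv_cat; exact: fp_eq_cat.
- by rewrite /fp_word_inv /= invg1; exact: fp_eq_inl1.
- by rewrite /fp_word_inv /= invg1; exact: fp_eq_inr1.
- by move=> a a'; rewrite /fp_word_inv /= invgM; exact: fp_eq_inlM.
- by move=> b b'; rewrite /fp_word_inv /= invgM; exact: fp_eq_inrM.
Qed.

Lemma pi_fp_inv w : fp_inv (\pi_freeprod w) = \pi_freeprod (fp_word_inv w).
Proof. by apply/fp_piP/asboolP/fp_eq_inv/fp_eq_repr. Qed.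

Lemma fp_eq_mulV w : fp_eq (w ++ fp_word_inv w) [::].
Proof.
elim: w => [|x w IHw]; first exact: fp_eq_refl.
rewrite -cat1s fp_word_inv_cat -catA (catA w).
apply: (@fp_eq_trans _ ([:: x] ++ ([::] ++ fp_word_inv [:: x]))).
  by apply: fp_eq_cat (fp_eq_refl _) (fp_eq_cat IHw (fp_eq_refl _)).
case: x => [a|b]; rewrite /fp_word_inv /=.
  by apply: fp_eq_trans (fp_eq_inlM _ _) _; rewrite mulgV; exact: fp_eq_inl1.
by apply: fp_eq_trans (fp_eq_inrM _ _) _; rewrite mulgV; exact: fp_eq_inr1.
Qed.

Lemma fp_word_invK : involutive fp_word_inv.
Proof.
move=> w; rewrite /fp_word_inv map_rev revK -map_comp -[RHS]map_id.
by apply: eq_map => -[a|b] /=; rewrite invgK.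
Qed.

Fact fp_mulA : associative fp_mul.
Proof.
elim/quotW => u; elim/quotW => v; elim/quotW => w.
by rewrite (pi_fp_mul v) (pi_fp_mul u) (pi_fp_mul u) (pi_fp_mul _ w) catA.
Qed.
Fact fp_mul1 : left_id fp_one fp_mul.
Proof. by elim/quotW => w; rewrite (pi_fp_mul [::]). Qed.
Fact fp_1mul : right_id fp_one fp_mul.
Proof. by elim/quotW => w; rewrite (pi_fp_mul _ [::]) cats0. Qed.
Fact fp_mulV : right_inverse fp_one fp_inv fp_mul.
Proof.
elim/quotW => w; rewrite (pi_fp_inv w) (pi_fp_mul w).
exact/fp_piP/asboolP/fp_eq_mulV.
Qed.
Fact fp_Vmul : left_inverse fp_one fp_inv fp_mul.
Proof.
elim/quotW => w; rewrite (pi_fp_inv w) (pi_fp_mul _ w).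
by apply/fp_piP/asboolP; rewrite -{2}[w]fp_word_invK; exact: fp_eq_mulV.
Qed.
HB.instance Definition _ :=
  isGroup.Build freeprod fp_mulA fp_mul1 fp_1mul fp_Vmul fp_mulV.

Section Lift.
Variables (H : groupType) (f : A -> H) (g : B -> H).

Definition fp_word_eval (w : word) : H :=
  (\prod_(x <- w) match x with inl a => f a | inr b => g b end)%g.

Definition fp_lift (x : freeprod) : H := fp_word_eval (repr x).
End Lift.

Section LiftMorphism.
Variables (H : groupType) (f : {multiplicative A -> H}).
Variable g : {multiplicative B -> H}.

Lemma multiplicative1 (K L : groupType) (h : {multiplicative K -> L}) :
  h 1%g = 1%g.
Proof. by apply: (@mulgI _ (h 1%g)); rewrite -gmulfM !mulg1. Qed.

Lemma fp_word_eval_eq v w : fp_eq v w -> fp_word_eval f g v = fp_word_eval f g w.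
Proof.
rewrite /fp_word_eval; elim=> {v w} //=.
- by move=> u v w _ -> _ ->.
- by move=> v v' w w' _ vv' _ ww'; rewrite !big_cat /= vv' ww'.
- by rewrite big_seq1 big_nil multiplicative1.
- by rewrite big_seq1 big_nil multiplicative1.
- by move=> a a'; rewrite big_cons !big_seq1 gmulfM.
- by move=> b b'; rewrite big_cons !big_seq1 gmulfM.
Qed.

Lemma fp_lift_pi w : fp_lift f g (\pi_freeprod w) = fp_word_eval f g w.
Proof. exact/fp_word_eval_eq/fp_eq_repr. Qed.

Lemma fp_liftM : {morph fp_lift f g : x y / (x * y)%g}.
Proof.
elim/quotW => v; elim/quotW => w.
rewrite -[(_ * _)%g in LHS]/(fp_mul _ _) (pi_fp_mul v w) !fp_lift_pi.
by rewrite /fp_word_eval big_cat.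
Qed.
End LiftMorphism.

End FreeProduct.

Section Generated.
Variable G : groupType.
Implicit Types X Y : set G.

Definition generated X : set G :=
  smallest [set H : set G | group_closed (fun x => x \in H)] X.

Definition in_generated X : {pred G} := fun x => x \in generated X.
Fact generated_group_closed X : group_closed (in_generated X).
Proof.
split; first by apply/mem_set => H [[H1 _] _]; exact: set_mem H1.
move=> x y /set_mem xX /set_mem yX; apply/mem_set => H HX.
have [[_ HV] _] := HX; apply/set_mem/HV; apply/mem_set.
  exact: xX.
exact: yX.
Qed.

Record subgroup_gen X := SubgroupGen {
  subgroup_gen_val :> G; _ : subgroup_gen_val \in in_generated X }.
HB.instance Definition _ X := [isSub for @subgroup_gen_val X].
HB.instance Definition _ X := [Choice of subgroup_gen X by <:].
HB.instance Definition _ X :=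
  SubChoice_isSubGroup.Build G (in_generated X) (subgroup_gen X)
    (generated_group_closed X).

Lemma generatedS X Y : X `<=` Y -> generated X `<=` generated Y.
Proof. by move=> XY x xX H [gH YH]; apply: xX; split=> // z /XY /YH. Qed.

Lemma subgroup_incl_subproof X Y (XY : X `<=` Y) (x : subgroup_gen X) :
  (x : G) \in in_generated Y.
Proof.
have xX : (x : G) \in generated X by exact: (valP x).
by apply/mem_set; apply: (generatedS XY); exact: set_mem xX.
Qed.
Definition subgroup_incl X Y (XY : X `<=` Y) (x : subgroup_gen X) :
  subgroup_gen Y := SubgroupGen (subgroup_incl_subproof XY x).

Fact subgroup_inclM X Y (XY : X `<=` Y) :
  {morph subgroup_incl XY : x y / (x * y)%g}.
Proof. by move=> x y; apply/val_inj. Qed.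

HB.instance Definition _ X Y (XY : X `<=` Y) :=
  monoid.isMultiplicative.Build _ _ (subgroup_incl XY) (subgroup_inclM XY).

Lemma sub_set1l (g f : G) : [set g] `<=` [set g; f].
Proof. by move=> x ->; left. Qed.
Lemma sub_set1r (g f : G) : [set f] `<=` [set g; f].
Proof. by move=> x ->; right. Qed.

Definition canonical_hom (g f : G) :
    freeprod (subgroup_gen [set g]) (subgroup_gen [set f]) ->
    subgroup_gen [set g; f] :=
  fp_lift (subgroup_incl (@sub_set1l g f)) (subgroup_incl (@sub_set1r g f)).

Lemma canonical_homM (g f : G) :
  {morph @canonical_hom g f : x y / (x * y)%g}.
Proof. exact: fp_liftM. Qed.

Definition free_from (g f : G) : Prop := bijective (@canonical_hom g f).

End Generated.

(* the free group of rank 2, as Z * Z *)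
Definition F2 : groupType :=
  freeprod (Algebra.to_multiplicative int) (Algebra.to_multiplicative int).

(* Main.v *)
(* Let d : G -> M = C1 / B1 be the universal derivation of the bar complex. If LG
   is localized at the non-zero elements of ZG, then each f != 1 determines a
   vector x_f = (f - 1)^-1 d(f) of M, and the elements g with d(g) = (g - 1) x_f
   form a subgroup D_f. If g and f satisfy a non-trivial relation, take one of
   minimal length: the proper prefixes of its word have distinct values, so the
   Fox derivative with respect to g does not vanish in ZG, and Fox calculus gives
   g \in D_f. As x_f is determined by any non-trivial element of D_f, distinct
   D_f intersect trivially. If every g != 1 were non-free from some f \in F, then
   G would be the union of finitely many such subgroups, and by torsion-freeness
   and pigeonhole one of them would be all of G; so d(g) = (g - 1) x for all g,
   and the cycles H_1 = ker (M -> LG) would vanish after localization,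
   contradicting betti_1 != 0.
   Affiliated operators are avoided by working in LG modulo torsion with respect
   to essential left ideals. This needs LG b to be essential for each non-zero b
   in ZG: for a != 0 there are s, t with s a = t b != 0. Indeed the
   kernel of (s, t) |-> s a - t b has dimension at least 1, whereas otherwise it
   would be the left annihilator of a, of dimension less than 1. *)
Require Import Defs.
From HB Require Import structures.
From mathcomp Require Import all_boot all_order all_algebra finmap complex.
From mathcomp Require Import boolp classical_sets functions cardinality.
From mathcomp Require Import reals ereal esum fsbigop filter.
From mathcomp Require Import topology normedtype sequences.
From mathcomp.multinomials Require Import -(notations) monalg.
From mathcomp Require Import ring lra zify.

Set Implicit Arguments.
Unset Strict Implicit.
Unset Printing Implicit Defensive.

Import Order.TTheory GRing.Theory Num.Theory.
Import numFieldNormedType.Exports.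

Local Open Scope classical_set_scope.
Local Open Scope ring_scope.
Local Open Scope quotient_scope.

(** * The Hilbert space of square-summable functions *)

Section SquaredNorm.
Variables (R : realType) (G : choiceType).
Local Notation l2 := (l2 R G).
Local Notation C := R[i].
Implicit Types (f g h : l2) (s t : seq l2).

Lemma l2D f g x : (f + g) x = f x + g x. Proof. by []. Qed.
Lemma l2N f x : (- f) x = - f x. Proof. by []. Qed.
Lemma l2Z (z : C) f x : (z *: f) x = z * f x. Proof. by []. Qed.
Lemma l20 x : (0 : l2) x = 0. Proof. by []. Qed.
Lemma l2_ext f g : (forall x, f x = g x) -> f = g.
Proof. by move=> fg; apply/val_inj/funext. Qed.

Definition l2E := (l2D, l2N, l2Z, l20).

Definition sqn f : R := fine (esqnorm f).

Lemma sqnE f : (sqn f)%:E = esqnorm f.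
Proof.
rewrite /sqn fineK// ge0_fin_numE ?esqnorm_ge0//.
by have /asboolP := valP f.
Qed.

Lemma sqn_ge0 f : 0 <= sqn f.
Proof. by rewrite -lee_fin sqnE esqnorm_ge0. Qed.

Lemma sqn_l2norm f : sqn f = l2norm f ^+ 2.
Proof. by apply: EFin_inj; rewrite sqnE esqnormE. Qed.

(* Squared norms are compared pointwise, which avoids infinite signed sums. *)
Lemma sum_sqn_eq s t :
  (forall x, \sum_(f <- s) abs2 (f x) = \sum_(f <- t) abs2 (f x)) ->
  \sum_(f <- s) sqn f = \sum_(f <- t) sqn f.
Proof.
move=> st; apply: EFin_inj; rewrite -!sumEFin.
have E u : (\sum_(f <- u) (sqn f)%:E
    = \esum_(x in [set: G]) (\sum_(f <- u) abs2 (f x))%:E)%E.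
  elim: u => [|f u IHu].
    by rewrite big_nil esum1// => x _; rewrite big_nil.
  under eq_esum => x _ do rewrite big_cons EFinD.
  rewrite big_cons IHu sqnE esumD//.
    by move=> x _; rewrite lee_fin abs2_ge0.
  by move=> x _; rewrite lee_fin sumr_ge0// => g _; exact: abs2_ge0.
by rewrite !E; apply: eq_esum => x _; rewrite st.
Qed.

(* The real part of the Hermitian inner product, by polarization *)
Definition ip f g : R := (sqn (f + g) - sqn (f - g)) / 4.

End SquaredNorm.

(* [ring] and [lra] would otherwise compare these atoms by unfolding them. *)
Ltac gen_atoms := repeat match goal with
  | |- context [ip ?f ?g] => generalize (ip f g)
  | |- context [sqn ?f] => generalize (sqn f)
  end.

Section HilbertSpace.
Variables (R : realType) (G : choiceType).
Local Notation l2 := (l2 R G).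
Local Notation C := R[i].
Implicit Types (f g h : l2) (c : R).

Definition imul f : l2 := ('i%C : C) *: f.

Lemma ipC f g : ip f g = ip g f.
Proof.
have := @sum_sqn_eq R G [:: f - g] [:: g - f].
rewrite !big_seq1 /ip [g + f]addrC => -> // x; rewrite !big_seq1 -[RHS]abs2N.
by congr abs2; rewrite /= opprB.
Qed.

Lemma ipDl f g h : ip (f + g) h = ip f h + ip g h.
Proof.
(* Additivity is a relation between six squared norms; moving the negative ones across leaves three
   on each side, the form that [sum_sqn_eq] handles. *)
have := @sum_sqn_eq R G [:: f + g + h; f - h; g - h] [:: f + g - h; f + h; g + h].
rewrite !big_cons !big_nil /ip => E.
have {}E := E _; have: sqn (f + g + h) + (sqn (f - h) + (sqn (g - h) + 0)) =
   sqn (f + g - h) + (sqn (f + h) + (sqn (g + h) + 0)).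
  apply: E => x; rewrite !big_cons !big_nil !l2E.
  by case: (f x) (g x) (h x) => [a b] [c d] [p q]; rewrite /abs2 /=; ring.
by gen_atoms => *; lra.
Qed.

Lemma ipDr f g h : ip h (f + g) = ip h f + ip h g.
Proof. by rewrite ipC ipDl !(ipC h). Qed.

Lemma ip0l f : ip 0 f = 0.
Proof. by apply: (addrI (ip 0 f)); rewrite -ipDl !addr0. Qed.

Lemma ip0r f : ip f 0 = 0.
Proof. by rewrite ipC ip0l. Qed.

Lemma ipNl f g : ip (- f) g = - ip f g.
Proof. by apply/eqP; rewrite -addr_eq0 -ipDl addNr ip0l. Qed.

Lemma ipNr f g : ip f (- g) = - ip f g.
Proof. by rewrite ipC ipNl ipC. Qed.

Lemma ipBl f g h : ip (f - g) h = ip f h - ip g h.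
Proof. by rewrite ipDl ipNl. Qed.

Lemma ipBr f g h : ip h (f - g) = ip h f - ip h g.
Proof. by rewrite ipDr ipNr. Qed.

Lemma sqnZ_le (z : C) f : sqn (z *: f) <= abs2 z * sqn f.
Proof.
rewrite -lee_fin EFinM !sqnE; apply: ge_ereal_sup => _ [X [finX XT] <-] /=.
under eq_fsbigr => x _ do rewrite abs2M EFinM.
rewrite -ge0_mule_fsumr; last by move=> x; rewrite lee_fin abs2_ge0.
by rewrite lee_wpmul2l ?lee_fin ?abs2_ge0//; apply: esum_ge; exists X.
Qed.

Lemma sqnZ (z : C) f : sqn (z *: f) = abs2 z * sqn f.
Proof.
apply/eqP; rewrite eq_le sqnZ_le /=; have [->|z0] := eqVneq z 0.
  by rewrite /abs2 /= expr0n addr0 mul0r sqn_ge0.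
have := @sqnZ_le z^-1 (z *: f); rewrite scalerA mulVf// scale1r => le_f.
apply: le_trans (ler_wpM2l (abs2_ge0 z) le_f) _.
by rewrite mulrA -abs2M mulfV// /abs2 /= expr0n addr0 expr1n mul1r.
Qed.

Lemma sqn0 : sqn (0 : l2) = 0.
Proof. by rewrite -[0](scale0r (0 : l2)) sqnZ /abs2 /= expr0n addr0 mul0r. Qed.

Lemma sqnN f : sqn (- f) = sqn f.
Proof. by rewrite sqn_l2norm l2normN -sqn_l2norm. Qed.

Lemma ipff f : ip f f = sqn f.
Proof.
rewrite /ip subrr sqn0 -[f + f]/(f *+ 2) -scaler_nat sqnZ.
rewrite (_ : abs2 _ = 4); first by field.
by rewrite -[2]/(1 + 1) /abs2 /=; ring.
Qed.

Lemma sqnD f g : sqn (f + g) = sqn f + 2 * ip f g + sqn g.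
Proof. by rewrite -!ipff ipDl !ipDr (ipC g f); gen_atoms => *; ring. Qed.

Lemma sqnB f g : sqn (f - g) = sqn f - 2 * ip f g + sqn g.
Proof. by rewrite sqnD sqnN ipNr mulrN. Qed.

Definition rscale c f : l2 := (c%:C)%C *: f.

Lemma ipZl c f g : ip (rscale c f) g = c * ip f g.
Proof.
wlog c0 : c / 0 <= c => [hw|].
  have [|/ltW c0] := leP 0 c; first exact: hw.
  have := hw (- c); rewrite oppr_ge0 => /(_ c0).
  by rewrite /rscale raddfN /= scaleNr ipNl mulNr => /oppr_inj.
(* For nonnegative [c] the weight is absorbed by rescaling vectors by its square root, so that
   [sum_sqn_eq] applies. *)
have E : sqn (rscale c f + g) + c * sqn (f - g)
       = sqn (rscale c f - g) + c * sqn (f + g).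
  have cE h : c * sqn h = sqn (rscale (Num.sqrt c) h).
    by rewrite sqnZ /abs2 /= expr0n addr0 sqr_sqrtr.
  rewrite !cE; have := @sum_sqn_eq R G
    [:: rscale c f + g; rscale (Num.sqrt c) (f - g)]
    [:: rscale c f - g; rscale (Num.sqrt c) (f + g)].
  rewrite !big_cons !big_nil !addr0; apply=> x.
  rewrite !big_cons !big_nil !l2E; have := sqr_sqrtr c0.
  move: (Num.sqrt c) => r <-.
  by case: (f x) (g x) => [a b] [p q]; rewrite /abs2 /=; ring.
move: E; rewrite /ip mulrA mulrBr; move: (c * sqn _) (c * sqn _).
by gen_atoms => *; lra.
Qed.

Lemma ipZr c f g : ip g (rscale c f) = c * ip g f.
Proof. by rewrite ipC ipZl ipC. Qed.

Lemma imulK f : imul (imul f) = - f.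
Proof. by rewrite /imul scalerA -expr2 sqr_i scaleN1r. Qed.

Lemma sqn_imul f : sqn (imul f) = sqn f.
Proof. by rewrite sqnZ /abs2 /= expr0n expr1n add0r mul1r. Qed.

Lemma ip_imul f g : ip (imul f) (imul g) = ip f g.
Proof. by rewrite /ip -scalerDr -scalerBr !sqn_imul. Qed.

Lemma ip_imulr f g : ip f (imul g) = - ip (imul f) g.
Proof. by rewrite -ip_imul imulK ipNr. Qed.

Lemma cauchy_schwarz f g : ip f g ^+ 2 <= sqn f * sqn g.
Proof.
(* Definiteness of [sqn] is only deduced later from this inequality, so [sqn g = 0] is treated
   apart: an affine function of [c] bounded below has slope zero. *)
have [g0|gn0] := eqVneq (sqn g) 0.
  have H c : 0 <= sqn f + 2 * (c * ip f g).
    have := sqn_ge0 (f + rscale c g).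
    by rewrite sqnD ipZr sqnZ g0 mulr0 addr0.
  have [->|ne] := eqVneq (ip f g) 0; first by rewrite g0 mulr0 expr0n.
  have := H (- (sqn f + 1) / ip f g); rewrite divfK//; have := sqn_ge0 f.
  by gen_atoms => *; lra.
have gp : 0 < sqn g by rewrite lt_def gn0 sqn_ge0.
have := sqn_ge0 (rscale (sqn g) f - rscale (ip f g) g).
rewrite sqnB ipZl ipZr !sqnZ /abs2 /= expr0n !addr0 => H.
have {}H : 0 <= sqn g * (sqn f * sqn g - ip f g ^+ 2).
  by move: H; gen_atoms => *; lra.
by rewrite -subr_ge0 -(pmulr_rge0 _ gp).
Qed.

Lemma ip_le f g : `|ip f g| <= l2norm f * l2norm g.
Proof.
rewrite -(@ler_pXn2r _ 2) ?nnegrE ?mulr_ge0 ?l2norm_ge0//.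
by rewrite exprMn -!sqn_l2norm real_normK ?num_real// cauchy_schwarz.
Qed.

Lemma abs2_eq0 (z : C) : (abs2 z == 0) = (z == 0).
Proof.
by case: z => a b; rewrite /abs2 /= paddr_eq0 ?sqr_ge0// !sqrf_eq0 eq_complex.
Qed.

Lemma sqn_split (f g h : l2) (A : set G) :
  (forall x, A x -> f x = g x) -> (forall x, ~ A x -> f x = h x) ->
  (forall x, A x -> h x = 0) -> (forall x, ~ A x -> g x = 0) ->
  sqn f = sqn g + sqn h.
Proof.
move=> fg fh h0 g0; have := @sum_sqn_eq R G [:: f] [:: g; h].
rewrite !big_cons !big_nil !addr0; apply=> x; rewrite !big_cons !big_nil !addr0.
have z0 : abs2 (0 : C) = 0 by apply/eqP; rewrite abs2_eq0.
have [Ax|Ax] := pselect (A x); first by rewrite fg// h0// z0 addr0.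
by rewrite fh// g0// z0 add0r.
Qed.

End HilbertSpace.

(** * The Riesz representation theorem *)

Section Riesz.
Variables (R : realType) (G : groupType).
Local Notation l2 := (l2 R G).
Local Notation C := R[i].
Local Notation delta := (@delta R G).
Implicit Types (f g h : l2) (x y : G).

Lemma deltaE x y : delta x y = (y == x)%:R.
Proof. by []. Qed.

Lemma sqn_delta x : sqn (delta x) = 1.
Proof.
apply: EFin_inj; rewrite sqnE /esqnorm (esumID [set x]); last first.
  by move=> y _; rewrite lee_fin abs2_ge0.
rewrite setTI esum_set1 ?lee_fin ?abs2_ge0//.
rewrite [X in (_ + X)%E]esum1 ?adde0.
  by rewrite /= eqxx /abs2 /= expr0n expr1n addr0.
by move=> y [_ /= xy]; case: eqP => // _; rewrite /abs2 /= expr0n /= addr0.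
Qed.

Lemma ip_delta f x (z : C) : ip f (z *: delta x) =
  complex.Re (f x) * complex.Re z + complex.Im (f x) * complex.Im z.
Proof.
rewrite -[in LHS](subrK (f x *: delta x) f) ipDl.
rewrite [X in X + _](_ : _ = 0) ?add0r; last first.
  (* The vector [f'] vanishes at [x], so it is orthogonal to every multiple of [delta x]. *)
  set f' := f - _; have E : sqn (f' + z *: delta x) = sqn (f' - z *: delta x).
    have := @sum_sqn_eq R G [:: f' + z *: delta x] [:: f' - z *: delta x].
    rewrite !big_seq1; apply=> y; rewrite !big_seq1 !l2E deltaE.
    case: eqVneq => [->|_]; last by rewrite !mulr0 !subr0 addr0.
    by rewrite !mulr1 subrr !add0r abs2N.
  by rewrite /ip E subrr mul0r.
rewrite /ip -scalerDl -scalerBl !sqnZ sqn_delta !mulr1.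
by case: (f x) z => [a b] [c d]; rewrite /abs2 /=; field.
Qed.

Lemma ip_delta1 f x : ip f (delta x) = complex.Re (f x).
Proof. by rewrite -[delta x]scale1r ip_delta /= mulr1 mulr0 addr0. Qed.

Lemma ip_idelta f x : ip f (imul (delta x)) = complex.Im (f x).
Proof. by rewrite ip_delta /= mulr1 mulr0 add0r. Qed.

Lemma l2_eqP f g : (forall h, ip f h = ip g h) -> f = g.
Proof.
move=> fg; apply: l2_ext => x; apply/eqP; rewrite eq_complex.
by rewrite -!ip_delta1 -!ip_idelta !fg !eqxx.
Qed.

Lemma sqn_eq0 f : sqn f = 0 -> f = 0.
Proof.
move=> f0; apply: l2_eqP => h; rewrite ip0l; apply/eqP.
rewrite -sqrf_eq0 eq_le sqr_ge0 andbT.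
by have := cauchy_schwarz f h; rewrite f0 mul0r.
Qed.

Definition trunc (s : seq G) (f : G -> C) : l2 := \sum_(x <- s) f x *: delta x.

Lemma truncE s (f : G -> C) y : uniq s -> trunc s f y = (y \in s)%:R * f y.
Proof.
rewrite /trunc; elim: s => [|x s IHs]; first by rewrite big_nil mul0r.
move=> /= /andP[xs us]; rewrite big_cons l2D IHs// l2Z deltaE inE.
case: eqVneq => [->|_] /=; first by rewrite (negbTE xs) mul0r addr0 mulrC.
by rewrite mulr0 add0r.
Qed.

Lemma sqn_trunc s (f : G -> C) : uniq s ->
  sqn (trunc s f) = \sum_(x <- s) abs2 (f x).
Proof.
move=> us; rewrite -ipff {2}/trunc.
have E u : ip (trunc s f) (\sum_(x <- u) f x *: delta x)
    = \sum_(x <- u) ip (trunc s f) (f x *: delta x).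
  elim: u => [|x u IHu]; first by rewrite !big_nil ip0r.
  by rewrite !big_cons ipDr IHu.
rewrite E big_seq [RHS]big_seq; apply: eq_bigr => x xs.
by rewrite ip_delta truncE// xs mul1r /abs2 !expr2.
Qed.

Lemma trunc_dense f e : 0 < e -> exists s, sqn (f - trunc s f) <= e.
Proof.
move=> e0; have fin : esqnorm f \is a fin_num by rewrite -sqnE.
have [_ [X [finX _] <-]] := ub_ereal_sup_adherent e0 fin.
rewrite -/(esum _ _) -/(esqnorm f) -sqnE -EFinB.
rewrite fsbig_finite//= sumEFin lte_fin => lt_e.
have us : uniq (enum_fset (fset_set X)) by exact: fset_uniq.
move: (enum_fset (fset_set X)) us lt_e => s us lt_e.
exists s; have : sqn f = sqn (trunc s f) + sqn (f - trunc s f).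
  have E x := truncE f x us.
  apply: (@sqn_split _ _ _ _ _ (fun x => x \in s)) => x xs.
  - by rewrite E xs mul1r.
  - by rewrite l2D l2N E (negbTE (introN idP xs)) mul0r subr0.
  - by rewrite l2D l2N E xs mul1r subrr.
  - by rewrite E (negbTE (introN idP xs)) mul0r.
by rewrite sqn_trunc//; move: lt_e; gen_atoms; move: (\sum_(_ <- s) _) => *; lra.
Qed.

Variables (L : l2 -> R) (K : R).
Hypothesis LD : {morph L : f g / f + g}.
Hypothesis LZ : forall c f, L (rscale c f) = c * L f.
Hypothesis LK : forall f, `|L f| <= K * l2norm f.

Let L0 : L 0 = 0.
Proof. by apply: (addrI (L 0)); rewrite -LD !addr0. Qed.

Let zeta x : C := (L (delta x) +i* L (imul (delta x)))%C.

Let L_delta (z : C) x :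
  L (z *: delta x) = complex.Re z * complex.Re (zeta x)
                   + complex.Im z * complex.Im (zeta x).
Proof.
rewrite -!LZ -LD; congr L; rewrite /rscale /imul scalerA -scalerDl.
by congr (_ *: _); case: z => a b; apply/eqP; rewrite eq_complex /=; apply/andP;
   split; apply/eqP; ring.
Qed.

(** Testing [L] on a truncation of [zeta] returns its squared norm, which is therefore at most [K]
    times its norm; all finite partial sums are thus bounded by [K ^+ 2]. *)
Let zeta_l2 : zeta \in @square_summable R G.
Proof.
apply/asboolP; apply: (@le_lt_trans _ _ (K ^+ 2)%:E); last exact: ltry.
apply: ge_ereal_sup => _ [X [finX _] <-]; rewrite fsbig_finite//=.
have us : uniq (enum_fset (fset_set X)) by exact: fset_uniq.
move: (enum_fset (fset_set X)) us => s us.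
rewrite sumEFin lee_fin.
have E : L (trunc s zeta) = sqn (trunc s zeta).
  rewrite sqn_trunc// /trunc; elim: (s : seq G) => [|x u IHu].
    by rewrite !big_nil L0.
  by rewrite !big_cons LD IHu L_delta /abs2 !expr2.
rewrite -sqn_trunc//; have := LK (trunc s zeta); rewrite E.
rewrite ger0_norm ?sqn_ge0// sqn_l2norm; have := l2norm_ge0 (trunc s zeta).
rewrite le_eqVlt => /predU1P[<- _|n0]; first by rewrite expr0n sqr_ge0.
rewrite expr2 ler_pM2r// => nK.
have K0 := le_trans (ltW n0) nK.
by rewrite -expr2 ler_pXn2r// nnegrE ltW.
Qed.

Lemma riesz : exists h, forall f, L f = ip f h.
Proof.
exists (L2 zeta_l2) => f; apply/eqP; rewrite -subr_eq0 -normr_eq0.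
rewrite eq_le normr_ge0 andbT; set h : l2 := L2 zeta_l2.
(* The two functionals agree on truncations, so by continuity only the tail of [f] contributes;
   [trunc_dense] makes it small. *)
have bound s : `|L f - ip f h| <= (`|K| + l2norm h) * l2norm (f - trunc s f).
  have E : L (trunc s f) = ip (trunc s f) h.
    rewrite /trunc; elim: s => [|x u IHu]; first by rewrite !big_nil L0 ip0l.
    rewrite !big_cons LD IHu ipDl L_delta [ip (_ *: _) _]ipC ip_delta/=.
    by rewrite 2!(mulrC (L _)).
  have -> : L f - ip f h = L (f - trunc s f) - ip (f - trunc s f) h.
    have -> : L f = L (f - trunc s f) + L (trunc s f) by rewrite -LD subrK.
    by rewrite ipBl E opprB addrA addrAC.
  apply: le_trans (ler_normB _ _) _; rewrite mulrDl lerD//.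
    by apply: le_trans (LK _) _; rewrite ler_wpM2r ?l2norm_ge0// ler_norm.
  by rewrite mulrC ip_le.
apply/ler_addgt0Pr => e e0; rewrite add0r.
set M := `|K| + l2norm h + 1.
have M0 : 0 < M by rewrite ltr_wpDl ?addr_ge0 ?l2norm_ge0.
have [s fs] := @trunc_dense f ((e / M) ^+ 2) (exprn_gt0 _ (divr_gt0 e0 M0)).
apply: le_trans (bound s) _; have {}fs : l2norm (f - trunc s f) <= e / M.
  have eM : 0 <= e / M by rewrite divr_ge0 ?ltW.
  by rewrite -(@ler_pXn2r _ 2) ?nnegrE ?l2norm_ge0// -sqn_l2norm.
apply: (@le_trans _ _ (M * (e / M))); last by rewrite mulrC divfK ?gt_eqF.
by rewrite ler_pM ?addr_ge0 ?l2norm_ge0// lerDl.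
Qed.

End Riesz.

(** * Adjoints and the trace on LG *)

Section Adjoint.
Variables (R : realType) (G : groupType).
Local Notation l2 := (l2 R G).
Local Notation C := R[i].
Local Notation bounded_op := (bounded_op R G).
Implicit Types (f g h : l2) (A B : bounded_op).

Lemma bounded_op0 A : A 0 = 0.
Proof. by apply: (addrI (A 0)); rewrite -bounded_opD !addr0. Qed.

Lemma bounded_opZ A (z : C) f : A (z *: f) = z *: A f.
Proof.
by have := bounded_op_linear A z f 0; rewrite bounded_op0 !addr0.
Qed.

Lemma bounded_opB A f g : A (f - g) = A f - A g.
Proof. by rewrite bounded_opD -scaleN1r bounded_opZ scaleN1r. Qed.

Lemma bounded_op_bound A :
  exists K, 0 <= K /\ forall f, l2norm (A f) <= K * l2norm f.
Proof.
case: A => T /= /asboolP[_ [K TK]]; exists `|K|; split=> // f.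
by apply: le_trans (TK f) _; rewrite ler_wpM2r ?l2norm_ge0 ?ler_norm.
Qed.

Lemma bounded_op_sqn A :
  exists K, 0 <= K /\ forall f, sqn (A f) <= K * sqn f.
Proof.
have [K [K0 AK]] := bounded_op_bound A; exists (K ^+ 2); split=> [|f].
  exact: sqr_ge0.
by rewrite !sqn_l2norm -exprMn ler_pXn2r ?nnegrE ?mulr_ge0 ?l2norm_ge0.
Qed.

Lemma scale_rscale (z : C) f :
  z *: f = rscale (complex.Re z) f + rscale (complex.Im z) (imul f).
Proof.
rewrite /rscale /imul scalerA -scalerDl; congr (_ *: _).
by case: z => a b; apply/eqP; rewrite eq_complex /=; apply/andP;
   split; apply/eqP; ring.
Qed.

(** Riesz gives the operator one argument at a time. The form is only real-bilinear, being the real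
    part of a sesquilinear one; its invariance under [imul] makes the operator complex-linear. This
    produces both adjoints and weak limits. *)
Lemma form_op (b : l2 -> l2 -> R) (K : R) : 0 <= K ->
  (forall f g h, b (f + g) h = b f h + b g h) ->
  (forall f g h, b h (f + g) = b h f + b h g) ->
  (forall c f h, b (rscale c f) h = c * b f h) ->
  (forall c f h, b h (rscale c f) = c * b h f) ->
  (forall f h, b (imul f) (imul h) = b f h) ->
  (forall f h, `|b f h| <= K * l2norm f * l2norm h) ->
  exists A, (forall f h, b f h = ip f (A h)) /\
            forall h, l2norm (A h) <= K * l2norm h.
Proof.
move=> K0 bDl bDr bZl bZr bi bK.
have ex h : exists k, forall f, b f h = ip f k.
  apply: (@riesz _ _ (b^~ h) (K * l2norm h)) => [f g|c f|f].
  - exact: bDl.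
  - exact: bZl.
  - by rewrite mulrAC bK.
pose T h := sval (cid (ex h)).
have TE f h : b f h = ip f (T h) by rewrite /T; case: (cid (ex h)).
have Ti h : T (imul h) = imul (T h).
  apply: l2_eqP => f; rewrite ipC -TE ipC ip_imulr -ipNl -TE -[RHS]bi; congr b.
  by rewrite /imul scalerN -/(imul f) -/(imul (imul f)) imulK opprK.
have TK h : l2norm (T h) <= K * l2norm h.
  have := bK (T h) h; rewrite TE ipff ger0_norm ?sqn_ge0//.
  rewrite sqn_l2norm expr2 mulrAC.
  have := l2norm_ge0 (T h); rewrite le_eqVlt => /predU1P[<- _|Tp].
    by rewrite mulr_ge0 ?l2norm_ge0.
  by rewrite ler_pM2r.
have Tlin : linear T.
  move=> z f h; apply: l2_eqP => k; rewrite ![ip _ k]ipC -TE bDr.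
  rewrite !scale_rscale bDr !bZr -Ti.
  by rewrite !ipDr !ipZr !TE.
have Tb : T \in @bounded_linear R G by apply/asboolP; split=> //; exists K.
by exists (BoundedOp Tb).
Qed.

Lemma adjoint_ex A : exists A', forall f h, ip (A f) h = ip f (A' h).
Proof.
have [K [K0 AK]] := bounded_op_bound A.
have [|||||||B [BE _]] := @form_op (fun f h => ip (A f) h) K.
- exact: K0.
- by move=> f g h; rewrite bounded_opD ipDl.
- by move=> f g h; rewrite ipDr.
- by move=> c f h; rewrite bounded_opZ -/(rscale c _) ipZl.
- by move=> c f h; rewrite ipZr.
- by move=> f h; rewrite bounded_opZ -/(imul _) ip_imul.
- move=> f h; apply: le_trans (ip_le _ _) _.
  by rewrite ler_wpM2r ?l2norm_ge0.
by exists B.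
Qed.

Definition adjoint A := sval (cid (adjoint_ex A)).

Lemma adjointE A f h : ip (A f) h = ip f (adjoint A h).
Proof. by rewrite /adjoint; case: (cid _). Qed.

Lemma adjointEr A f h : ip f (A h) = ip (adjoint A f) h.
Proof. by rewrite ipC adjointE ipC. Qed.

End Adjoint.

Section VonNeumannStar.
Variables (R : realType) (G : groupType).
Local Notation l2 := (l2 R G).
Local Notation C := R[i].
Local Notation bounded_op := (bounded_op R G).
Local Notation LG := (group_vN R G).
Local Notation delta := (@delta R G).
Local Notation lreg := (@left_regular R G).
Implicit Types (f g h : l2) (A B : bounded_op) (a b : LG) (x y : G).

Lemma sqn_ltrans x f : sqn (ltrans x f) = sqn f.
Proof. by rewrite /sqn /= esqnorm_ltrans. Qed.

Lemma ip_ltrans x f h : ip (lreg x f) h = ip f (lreg x^-1%g h).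
Proof.
have E g k : ip (lreg x g) (lreg x k) = ip g k.
  by rewrite /ip -bounded_opD -bounded_opB /= !sqn_ltrans.
rewrite -[RHS]E; congr ip; apply: l2_ext => y /=.
by rewrite /ltrans_fun /= invgK mulVKg.
Qed.

Local Notation comm := (commutant (range lreg)).

Lemma commP A : comm A <-> forall x f, A (lreg x f) = lreg x (A f).
Proof.
split=> [cA x f|cA _ [x _ <-]].
  by have /(congr1 (fun B : bounded_op => B f)) := cA _ (imageT lreg x).
by apply: bounded_opP => f; exact: cA.
Qed.

Lemma comm_adjoint A : comm A -> comm (adjoint A).
Proof.
move=> /commP cA; apply/commP => x f; apply: l2_eqP => h; rewrite ipC -adjointE.
by rewrite ipC ip_ltrans [RHS]ip_ltrans ipC -cA adjointE ipC.
Qed.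

Lemma group_vNP A : reflect (forall B, comm B -> forall f, A (B f) = B (A f))
                            (A \in @in_group_vN R G).
Proof.
apply: (iffP (asboolP _)) => [cA B cB f|cA B cB].
  by have /(congr1 (fun T : bounded_op => T f)) := cA _ cB.
by apply: bounded_opP => f; exact: cA.
Qed.

Lemma vN_comm a B f : comm B -> a (B f) = B (a f).
Proof. by case: a => A /= /group_vNP cA cB; exact: cA. Qed.

(** LG is the commutant of [comm], and [comm] is closed under adjoints because left translations are
    unitary. *)
Lemma star_subproof a : adjoint a \in @in_group_vN R G.
Proof.
apply/group_vNP => B cB f; apply: l2_eqP => h; rewrite ipC [RHS]ipC.
rewrite -adjointE [in RHS]adjointEr -adjointE (vN_comm a); last exact: comm_adjoint.
by rewrite adjointEr.
Qed.

Definition star a : LG := GroupVN (star_subproof a).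

Lemma starE a f h : ip (a f) h = ip f (star a h).
Proof. exact: adjointE. Qed.

Lemma vNM a b f : (a * b) f = a (b f). Proof. by []. Qed.
Lemma vND a b f : (a + b) f = a f + b f. Proof. by []. Qed.
Lemma vNN a f : (- a) f = - a f. Proof. by []. Qed.
Lemma vN0 f : (0 : LG) f = 0. Proof. by []. Qed.
Lemma vN1 f : (1 : LG) f = f. Proof. by []. Qed.

Lemma vN_eqP a b : (forall f, a f = b f) -> a = b.
Proof. by move=> ab; apply/val_inj/bounded_opP. Qed.

Lemma starK : involutive star.
Proof.
move=> a; apply: vN_eqP => f; apply: l2_eqP => h.
by rewrite ipC -starE ipC -starE.
Qed.

Lemma starEr a f h : ip f (a h) = ip (star a f) h.
Proof. by rewrite ipC starE ipC. Qed.

Lemma starM a b : star (a * b) = star b * star a.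
Proof.
apply: vN_eqP => f; apply: l2_eqP => h; rewrite ipC [RHS]ipC.
by rewrite -starE !vNM !starE.
Qed.

Lemma starB a b : star (a - b) = star a - star b.
Proof.
apply: vN_eqP => f; apply: l2_eqP => h; rewrite ipC [RHS]ipC.
by rewrite -starE !vND !vNN ipBl ipBr !starE.
Qed.

Lemma star0 : star 0 = 0.
Proof. by rewrite -[X in star X](subrr 0) starB subrr. Qed.

Lemma starD a b : star (a + b) = star a + star b.
Proof. by rewrite -[b in LHS]opprK starB -[- b]sub0r starB star0 sub0r opprK. Qed.

Lemma star1 : star 1 = 1.
Proof. by rewrite -[LHS]mulr1 -[X in _ * X]starK -starM mulr1 starK. Qed.

Lemma star_mul_eq0 a : star a * a = 0 -> a = 0.
Proof.
move=> a0; apply: vN_eqP => f; apply: sqn_eq0.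
by rewrite -ipff starE -vNM a0 ip0r.
Qed.

Definition rtrans_fun y (f : G -> C) : G -> C := fun x => f (x * y)%g.

Lemma esqnorm_rtrans y f : esqnorm (rtrans_fun y f) = esqnorm f.
Proof.
rewrite /esqnorm (reindex_esum setT setT (fun x => x * y^-1)%g).
  by apply: eq_esum => x _; rewrite /rtrans_fun mulgVK.
split=> // [x z _ _ /mulIg//|x _].
by exists (x * y)%g => //; rewrite mulgK.
Qed.

Lemma rtrans_subproof y (f : l2) : rtrans_fun y f \in @square_summable R G.
Proof. by apply/asboolP; rewrite esqnorm_rtrans; have /asboolP := valP f. Qed.
Definition rtrans y (f : l2) : l2 := L2 (rtrans_subproof y f).

Lemma rtrans_bounded y : rtrans y \in @bounded_linear R G.
Proof.
apply/asboolP; split=> [a f h|]; first exact/val_inj.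
by exists 1 => f; rewrite mul1r /l2norm /= esqnorm_rtrans.
Qed.
Definition right_regular y : bounded_op := BoundedOp (rtrans_bounded y).

Lemma comm_right_regular y : comm (right_regular y).
Proof.
apply/commP => x f; apply: l2_ext => z /=.
by rewrite /ltrans_fun /rtrans_fun /= /ltrans_fun /= mulgA.
Qed.

Lemma vN_deltaE a x y : (a (delta x)) y = (a (delta 1%g)) (y * x^-1)%g.
Proof.
have -> : delta x = right_regular x^-1%g (delta 1%g).
  apply: l2_ext => z /=; rewrite /rtrans_fun /=.
  congr (nat_of_bool _)%:R; apply/eqP/eqP => [->|/(congr1 (fun t => t * x)%g)].
    by rewrite mulgV.
  by rewrite mulgVK mul1g.
by rewrite (vN_comm a _ (comm_right_regular _)).
Qed.

(** [delta 1] is a separating vector: right translations commute with LG, so [a - b] kills every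
    [delta x]. Hence all coordinates of the values of its adjoint vanish. *)
Lemma vN_delta_inj a b : a (delta 1%g) = b (delta 1%g) -> a = b.
Proof.
move=> ab; suff: star (a - b) = 0.
  move/(congr1 star); rewrite starK star0 => /eqP.
  by rewrite subr_eq0 => /eqP.
have ab0 x : (a - b) (delta x) = 0.
  by apply: l2_ext => y; rewrite vN_deltaE vND vNN ab subrr.
apply: vN_eqP => f; apply: l2_ext => x; apply/eqP.
rewrite eq_complex -!ip_delta1 -!ip_idelta !(ipC (star _ _)) -!starE.
by rewrite bounded_opZ ab0 scaler0 vN0 !ip0l !eqxx.
Qed.

Definition flip_fun (f : G -> C) : G -> C := fun x => ((f x^-1%g)^*)%C.

Lemma esqnorm_flip f : esqnorm (flip_fun f) = esqnorm f.
Proof.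
rewrite /esqnorm (reindex_esum setT setT (fun x => x^-1)%g).
  apply: eq_esum => x _; rewrite /flip_fun invgK.
  by case: (f x) => u v; rewrite /abs2 /= sqrrN.
split=> // [x z _ _ /invg_inj//|x _].
by exists (x^-1)%g => //; rewrite invgK.
Qed.

Lemma flip_subproof (f : l2) : flip_fun f \in @square_summable R G.
Proof. by apply/asboolP; rewrite esqnorm_flip; have /asboolP := valP f. Qed.
Definition flip (f : l2) : l2 := L2 (flip_subproof f).

Lemma flipE f x : flip f x = ((f x^-1%g)^*)%C. Proof. by []. Qed.

Lemma flipK : involutive flip.
Proof.
move=> f; apply: l2_ext => x /=; rewrite /flip_fun /= /flip_fun invgK.
by case: (f x) => u v /=; rewrite opprK.
Qed.

Lemma ip_flip f h : ip (flip f) (flip h) = ip f h.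
Proof.
have sqn_flip k : sqn (flip k) = sqn k by rewrite /sqn /= esqnorm_flip.
have flipD k l : flip k + flip l = flip (k + l).
  by apply: l2_ext => x; rewrite l2D !flipE l2D rmorphD.
have flipN k : - flip k = flip (- k).
  by apply: l2_ext => x; rewrite l2N !flipE l2N rmorphN.
by rewrite /ip flipN !flipD !sqn_flip.
Qed.

Lemma star_delta a : star a (delta 1%g) = flip (a (delta 1%g)).
Proof.
apply: l2_ext => x; rewrite flipE; apply/eqP; rewrite eq_complex.
have -> : complex.Re (star a (delta 1%g) x) = complex.Re (a (delta 1%g) x^-1%g).
  by rewrite -ip_delta1 ipC -starE ip_delta1 vN_deltaE mul1g.
have -> : complex.Im (star a (delta 1%g) x) = - complex.Im (a (delta 1%g) x^-1%g).
  rewrite -ip_idelta ipC -starE bounded_opZ ip_delta1 l2Z vN_deltaE mul1g.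
  by case: (a _ _) => u v /=; rewrite mul0r mul1r sub0r.
by case: (a _ _) => u v; rewrite !eqxx.
Qed.

Definition tr a : R := ip (a (delta 1%g)) (delta 1%g).

(** Both traces are inner products of [delta 1] images, and the isometric involution [flip]
    exchanges those of an element and of its adjoint. *)
Lemma trC a b : tr (a * b) = tr (b * a).
Proof.
rewrite /tr !vNM starE [RHS]starE !star_delta -[RHS]ip_flip flipK.
by rewrite ipC.
Qed.

Lemma trD a b : tr (a + b) = tr a + tr b.
Proof. by rewrite /tr vND ipDl. Qed.

Lemma trB a b : tr (a - b) = tr a - tr b.
Proof. by rewrite /tr vND vNN ipBl. Qed.

Lemma tr1 : tr 1 = 1.
Proof. by rewrite /tr vN1 ipff sqn_delta. Qed.

End VonNeumannStar.

(** * Weak limits and common left multiples *)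

Section WeakLimit.
Variables (R : realType) (G : groupType).
Local Notation l2 := (l2 R G).
Local Notation LG := (group_vN R G).
Implicit Types (f g h : l2) (a b : LG).
Variables (U : set_system nat) (UU : UltraFilter U).

(** By compactness of the interval the image filter has a cluster point, and an ultrafilter
    converges to each of its cluster points. *)
Lemma ultra_bounded_cvg (u : nat -> R) (K : R) :
  (forall j, `|u j| <= K) -> cvg (u @ U).
Proof.
move=> uK; have FU : ProperFilter (u @ U).
  by apply: fmap_proper_filter; exact: ultra_proper.
have sU : (u @ U) `[- K, K]%classic.
  apply: (@filterS _ U _ setT) => [j _|]; last exact: filterT.
  by rewrite /= in_itv /= -ler_norml.
have [l [_ ul]] := @segment_compact R (- K) K _ FU sU.
apply/cvg_ex; exists l => N lN.
have [//|UNc] := in_ultra_setVsetC (u @^-1` N) UU.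
by have [x [/= + /=]] := ul (~` N) N UNc lN.
Qed.

(** Weak compactness of bounded sets in LG: the limits of the forms along [U] satisfy the hypotheses
    of [form_op], and commuting with [comm] passes to weak limits. The ultrafilter stands in for
    extracting subsequences. *)
Lemma weak_limit (x : nat -> LG) (K : R) : 0 <= K ->
  (forall j h, l2norm (x j h) <= K * l2norm h) ->
  exists X : LG, (forall f h, (fun j => ip f (x j h)) @ U --> ip f (X h)) /\
                 forall h, l2norm (X h) <= K * l2norm h.
Proof.
move=> K0 xK; have FU : ProperFilter U by exact: ultra_proper.
have bound f h j : `|ip f (x j h)| <= K * l2norm f * l2norm h.
  apply: le_trans (ip_le _ _) _; rewrite mulrAC mulrC.
  by rewrite ler_wpM2r ?l2norm_ge0.
have cv f h : cvg ((fun j => ip f (x j h)) @ U).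
  by apply: ultra_bounded_cvg (bound f h).
pose b f h := lim ((fun j => ip f (x j h)) @ U).
have bE f h : (fun j => ip f (x j h)) @ U --> b f h by exact: cv.
have blim f h l : (fun j => ip f (x j h)) @ U --> l -> b f h = l.
  by move=> /(cvg_lim (@norm_hausdorff _ _)).
have [|||||||A [AE AK]] := @form_op R G b K.
- exact: K0.
- move=> f g h; apply: blim; under eq_fun do rewrite ipDl.
  by apply: cvgD; exact: bE.
- move=> f g h; apply: blim; under eq_fun do rewrite bounded_opD ipDr.
  by apply: cvgD; exact: bE.
- move=> c f h; apply: blim; under eq_fun do rewrite ipZl.
  by apply: cvgMr; exact: bE.
- move=> c f h; apply: blim.
  under eq_fun do rewrite bounded_opZ -/(rscale c _) ipZr.
  by apply: cvgMr; exact: bE.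
- move=> f h; apply: blim.
  under eq_fun do rewrite bounded_opZ -/(imul _) ip_imul.
  exact: bE.
- move=> f h; rewrite ler_norml.
  have P j : - (K * l2norm f * l2norm h) <= ip f (x j h) <= K * l2norm f * l2norm h.
    by rewrite -ler_norml.
  apply/andP; split.
    by apply: cvgr_to_ge (bE f h) _; apply: nearW => j; have /andP[] := P j.
  by apply: cvgr_to_le (bE f h) _; apply: nearW => j; have /andP[] := P j.
have AG : A \in @in_group_vN R G.
  apply/group_vNP => B cB f; apply: l2_eqP => h; rewrite ipC [RHS]ipC.
  rewrite -AE adjointEr -AE; apply: blim.
  under eq_fun do rewrite (vN_comm _ _ cB) adjointEr.
  exact: bE.
by exists (GroupVN AG); split=> // f h; rewrite /= -AE; exact: bE.
Qed.

End WeakLimit.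

Section CommonMultiple.
Variables (R : realType) (G : groupType).
Local Notation l2 := (l2 R G).
Local Notation LG := (group_vN R G).
Local Notation delta := (@delta R G).
Implicit Types (f g h : l2) (a b : LG).

(** It is applied to [g = x f] with [x] a positive contraction, the hypothesis expressing that x^* x
    is at most x. *)
Lemma contraction_bound f g : sqn g <= ip f g ->
  ip f g <= sqn f /\ sqn g <= sqn f.
Proof.
move=> gf; have := sqn_ge0 (f - g); rewrite sqnB.
by move: gf; gen_atoms => *; split; lra.
Qed.

Lemma sqn_l2norm_le f g : sqn f <= sqn g -> l2norm f <= 1 * l2norm g.
Proof.
by rewrite mul1r !sqn_l2norm ler_pXn2r// nnegrE l2norm_ge0.
Qed.

(* [q j] tends to the inverse of [D], so that the matrix
   [[1 - a q a^*, - a q b^*], [- b q a^*, 1 - b q b^*]] tends to the projection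
   onto the orthogonal complement of the range of the column [(a, b)], whose trace
   is at least [2 - 1]. Its rows are solutions [(s, - t)] of [s * a = t * b]. *)
Section Contraction.
Variables (a b : LG).
Let D := star a * a + star b * b.
Hypothesis D_le : forall f, sqn (D f) <= ip f (D f).
Hypothesis b_inj : forall f, b f = 0 -> f = 0.
Hypothesis b_rreg : forall x, x * b = 0 -> x = 0.
Hypothesis ab0 : forall s t, s * a = t * b -> s * a = 0.

Let S := 1 - D.
Let q j := \sum_(0 <= i < j) S ^+ i.

Let ip_D f g : ip f (D g) = ip (a f) (a g) + ip (b f) (b g).
Proof. by rewrite /D vND ipDr !vNM -!starE. Qed.

Let star_D : star D = D.
Proof.
apply: vN_eqP => f; apply: l2_eqP => h.
by rewrite -starEr ip_D [RHS]ipC ip_D [ip (a h) _]ipC [ip (b h) _]ipC.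
Qed.

Let starS : star S = S.
Proof. by rewrite /S starB star_D star1. Qed.

Let starSX i : star (S ^+ i) = S ^+ i.
Proof. by elim: i => [|i IHi]; rewrite ?star1// {1}exprS starM IHi starS -exprSr. Qed.

Let starq j : star (q j) = q j.
Proof.
elim: j => [|j IHj]; first by rewrite /q big_geq// star0.
by rewrite /q big_nat_recr//= starD -/(q j) IHj starSX.
Qed.

Let qD j : q j * D = 1 - S ^+ j.
Proof.
elim: j => [|j IHj]; first by rewrite /q big_geq// mul0r expr0 subrr.
have DE : D = 1 - S by rewrite /S opprB addrC subrK.
rewrite /q big_nat_recr//= mulrDl -/(q j) IHj exprSr [in LHS]DE mulrBr mulr1.
by rewrite addrA subrK.
Qed.

Let Dq j : D * q j = 1 - S ^+ j.
Proof.
by rewrite -[LHS]starK starM starq star_D qD starB star1 starSX.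
Qed.

(** Half of the power is moved to each side by self-adjointness, leaving a squared norm for even [i]
    and one factor [S] in the middle for odd [i]. *)
Let SX_ge0 i f : 0 <= ip f ((S ^+ i) f).
Proof.
have S_ge0 g : 0 <= ip g (S g).
  rewrite /S vND vNN vN1 ipBr ipff.
  by rewrite subr_ge0; have [] := contraction_bound (D_le g).
have -> : i = (i./2 + (odd i + i./2))%N by rewrite addnCA addnn odd_double_half.
rewrite exprD vNM starEr starSX exprD vNM.
by case: (odd i); rewrite ?expr1 // expr0 vN1 ipff sqn_ge0.
Qed.

Let qSX_ge0 i j f : 0 <= ip f ((S ^+ i * q j) f).
Proof.
rewrite /q mulr_sumr; elim: j => [|j IHj]; first by rewrite big_geq// vN0 ip0r.
by rewrite big_nat_recr// vND ipDr addr_ge0// -exprD.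
Qed.

(** The left side is the form of q D q, and q - q D q = S^j q is positive. *)
Let q_bound j f : sqn (a (q j f)) + sqn (b (q j f)) <= ip f (q j f).
Proof.
have := ip_D (q j f) (q j f); rewrite !ipff => <-.
rewrite -vNM Dq vND vNN vN1 ipBr ipC lerBlDr lerDl.
by rewrite starEr starSX -vNM ipC; exact: qSX_ge0.
Qed.

(** With the argument [star a f], [q_bound] bounds a whole column of the matrix by its diagonal
    entry, uniformly in [j]; this supplies the bounds for weak limits. *)
Let qa_bound j f :
  sqn ((a * q j * star a) f) <= ip f ((a * q j * star a) f) /\
  sqn ((b * q j * star a) f) <= sqn f.
Proof.
have := q_bound j (star a f); rewrite -starEr !vNM.
set v := a _; set w := b _ => vw.
have vf : sqn v <= ip f v.
  by apply: le_trans vw; rewrite lerDl sqn_ge0.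
split=> //; have [+ _] := contraction_bound vf; apply: le_trans.
by apply: le_trans vw; rewrite lerDr sqn_ge0.
Qed.

Let qb_bound j f :
  sqn ((b * q j * star b) f) <= ip f ((b * q j * star b) f) /\
  sqn ((a * q j * star b) f) <= sqn f.
Proof.
have := q_bound j (star b f); rewrite -starEr !vNM.
set v := a _; set w := b _ => vw.
have wf : sqn w <= ip f w.
  by apply: le_trans vw; rewrite lerDr sqn_ge0.
split=> //; have [+ _] := contraction_bound wf; apply: le_trans.
by apply: le_trans vw; rewrite lerDl sqn_ge0.
Qed.

Let compl_bound (x : LG) f : sqn (x f) <= ip f (x f) ->
  sqn ((1 - x) f) <= sqn f.
Proof.
rewrite vND vNN vN1 sqnB => xf; have := sqn_ge0 (x f).
by move: xf; gen_atoms => *; lra.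
Qed.

Let S_step f : sqn (D f) <= sqn f - sqn (S f).
Proof.
have -> : S f = f - D f by []; rewrite sqnB; have := D_le f.
by gen_atoms => *; lra.
Qed.

(** By [S_step] the squared norms of S^j f decrease, and their successive differences, which tend to
    0, dominate those of D S^j f. *)
Let DSX_cvg f h : (fun j => ip h (D ((S ^+ j) f)) ^+ 2) @ \oo --> 0.
Proof.
pose u j := sqn ((S ^+ j) f).
have uS j : sqn (D ((S ^+ j) f)) <= u j - u j.+1.
  by apply: le_trans (S_step _) _; rewrite /u exprS vNM.
have u_cvg : cvg (u @ \oo).
  apply: nonincreasing_is_cvgn.
    apply/nonincreasing_seqP => j; rewrite -subr_ge0.
    exact: le_trans (sqn_ge0 _) (uS j).
  by exists 0 => _ [j _ <-]; exact: sqn_ge0.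
have du : (fun j => u j - u j.+1) @ \oo --> 0.
  rewrite -(subrr (lim (u @ \oo))); apply: cvgB => //.
  by rewrite (cvg_shiftS u).
apply: (@squeeze_cvgr _ _ _ _ (fun=> 0) (fun j => sqn h * (u j - u j.+1))).
- apply: nearW => j; rewrite sqr_ge0 /=.
  by apply: le_trans (cauchy_schwarz _ _) _; rewrite ler_wpM2l ?sqn_ge0 ?uS.
- exact: cvg_cst.
by rewrite -[X in _ --> X](mulr0 (sqn h)); apply: cvgMr.
Qed.

Lemma contraction_common_multiple : a = 0.
Proof.
have [U [UU oU]] := @ultraFilterLemma _ (\oo : set_system nat) _.
have FU : ProperFilter U by exact: ultra_proper.
have wlim (x : nat -> LG) : (forall j f, sqn (x j f) <= sqn f) ->
    exists X : LG, (forall f h, (fun j => ip f (x j h)) @ U --> ip f (X h)) /\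
                   forall h, sqn (X h) <= sqn h.
  move=> xK; have [|X [Xlim XK]] := @weak_limit R G U UU x 1 ler01.
    by move=> j h; apply/sqn_l2norm_le.
  exists X; split=> // h; have := XK h; rewrite mul1r !sqn_l2norm.
  by rewrite ler_pXn2r// nnegrE l2norm_ge0.
have lim_uniq (u : nat -> R) (l l' : R) : u @ U --> l -> u @ U --> l' -> l = l'.
  move=> ul ul'; rewrite -(cvg_lim (@norm_hausdorff _ _) ul).
  by rewrite -(cvg_lim (@norm_hausdorff _ _) ul').
have SX_contr j f : sqn ((S ^+ j) f) <= sqn f.
  elim: j f => [|j IHj] f; first by rewrite expr0 vN1.
  rewrite exprS vNM; apply: le_trans (IHj f).
  rewrite -subr_ge0; exact: le_trans (sqn_ge0 _) (S_step _).
(* A weak limit [E] of the powers of [S] satisfies D E = 0, and [D] is injective because [b] is. *)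
have S0 f h : (fun j => ip f ((S ^+ j) h)) @ U --> 0.
  have [E [Elim _]] := wlim _ SX_contr.
  suff -> : 0 = ip f (E h) by exact: Elim.
  have DE : D (E h) = 0.
    apply: l2_eqP => k; rewrite ip0l ipC; apply/eqP; rewrite -sqrf_eq0; apply/eqP.
    apply: (lim_uniq (fun j => ip k (D ((S ^+ j) h)) ^+ 2)); last first.
      exact: cvg_trans (cvg_app _ oU) (DSX_cvg _ _).
    rewrite starEr expr2; under eq_fun do rewrite starEr expr2.
    by apply: cvgM; exact: Elim.
  suff -> : E h = 0 by rewrite ip0r.
  apply: b_inj; apply: sqn_eq0; apply/eqP; rewrite eq_le sqn_ge0 andbT.
  have := ip_D (E h) (E h); rewrite DE ip0r !ipff => /esym/eqP.
  by rewrite paddr_eq0 ?sqn_ge0// => /andP[_ /eqP->].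
have [X [Xlim Xc]] := wlim (fun j => 1 - a * q j * star a)
  (fun j f => compl_bound (qa_bound j f).1).
have [Y [Ylim _]] := wlim (fun j => a * q j * star b) (fun j f => (qb_bound j f).2).
have [Y' [Y'lim _]] := wlim (fun j => b * q j * star a) (fun j f => (qa_bound j f).2).
have [Z [Zlim Zc]] := wlim (fun j => 1 - b * q j * star b)
  (fun j f => compl_bound (qb_bound j f).1).
(* The j-th matrix sends the column (a, b) to (a S^j, b S^j), which tends weakly to 0; the limits
   then give two common left multiples. *)
have E1 j : (1 - a * q j * star a) * a - a * q j * star b * b = a * S ^+ j.
  rewrite mulrBl mul1r -addrA -opprD -!mulrA -!mulrDr -/D qD.
  by rewrite mulrBr mulr1 opprB addrC subrK.
have E2 j : (1 - b * q j * star b) * b - b * q j * star a * a = b * S ^+ j.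
  rewrite mulrBl mul1r -addrA -opprD [_ * b + _]addrC -!mulrA -!mulrDr -/D qD.
  by rewrite mulrBr mulr1 opprB addrC subrK.
have lim_eq (x y c d e : LG) (x_ y_ : nat -> LG) :
    (forall f h, (fun j => ip f (x_ j h)) @ U --> ip f (x h)) ->
    (forall f h, (fun j => ip f (y_ j h)) @ U --> ip f (y h)) ->
    (forall j, x_ j * c - y_ j * d = e * S ^+ j) -> x * c = y * d.
  move=> xlim ylim E; apply: vN_eqP => f; apply/eqP; rewrite -subr_eq0.
  apply/eqP; apply: l2_eqP => h; rewrite ip0l ipC !vNM ipBr.
  apply: (lim_uniq _ _ _ (cvgB (xlim h (c f)) (ylim h (d f)))).
  rewrite [X in X @ _](_ : _ = fun j => ip (star e h) ((S ^+ j) f)); first exact: S0.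
  apply/funext => j; rewrite -starEr -[RHS]/(ip h ((e * S ^+ j) f)) -E.
  by rewrite vND vNN !vNM ipBr.
have XY : X * a = Y * b by exact: lim_eq Xlim Ylim E1.
have ZY : Z * b = Y' * a by exact: lim_eq Zlim Y'lim E2.
have Xa : X * a = 0 by exact: ab0 XY.
have Z0 : Z = 0 by apply: b_rreg; rewrite ZY; apply: (ab0 (esym ZY)).
pose d := delta 1%g; have trE (x : LG) : ip d (x d) = tr x by rewrite ipC.
(* Cyclicity turns the two subtracted traces into the trace of q D = 1 - S^j, so the total is 2 - (1
   - tr S^j). *)
have tr_sum j : tr (1 - a * q j * star a) + tr (1 - b * q j * star b)
              = 1 + tr (S ^+ j).
  rewrite !trB tr1 -!mulrA [tr (a * _)]trC [tr (b * _)]trC -!mulrA.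
  rewrite addrACA -opprD -trD -mulrDr -/D qD trB tr1.
  by move: (tr _) => r; ring.
have trX : tr X + tr Z = 1.
  rewrite -!trE; apply: (lim_uniq _ _ _ (cvgD (Xlim d d) (Zlim d d))).
  rewrite [X in X @ _](_ : _ = fun j => 1 + ip d ((S ^+ j) d)).
    by rewrite -[X in _ --> X]addr0; apply: cvgD; [exact: cvg_cst|exact: S0].
  by apply/funext => j; rewrite trE -tr_sum -!trE.
(* As [Z = 0], [X] is a contraction of trace 1, so |X d - d|^2 is at most 1 - 2 + 1 = 0, and [d] is
   separating. Then [X * a = 0] reads [a = 0]. *)
have X1 : X = 1.
  apply: vN_delta_inj; apply/eqP; rewrite vN1 -subr_eq0; apply/eqP/sqn_eq0.
  apply/eqP; rewrite eq_le sqn_ge0 andbT sqnB.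
  have := Xc d; rewrite /d sqn_delta.
  by move: trX; rewrite Z0 {2}/tr vN0 ip0l addr0 /tr => ->; gen_atoms => *; lra.
by rewrite -[a]mul1r -X1.
Qed.
End Contraction.

Lemma rscale_bounded c : @rscale R G c \in @bounded_linear R G.
Proof.
apply/asboolP; split=> [z f h|].
  by rewrite /rscale scalerDr !scalerA mulrC.
exists (`|c|) => f; rewrite /l2norm -!/(sqn _) sqnZ /abs2 /= expr0n addr0.
by rewrite sqrtrM ?sqr_ge0// sqrtr_sqr.
Qed.

Lemma rscale_vN c : BoundedOp (rscale_bounded c) \in @in_group_vN R G.
Proof. by apply/group_vNP => B _ f /=; rewrite bounded_opZ. Qed.
Definition scalar_vN c : LG := GroupVN (rscale_vN c).

Lemma scalar_vNE c f : scalar_vN c f = rscale c f. Proof. by []. Qed.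

Lemma scalar_vN_eq0 c a : c != 0 -> scalar_vN c * a = 0 -> a = 0.
Proof.
move=> c0 ca; apply: vN_eqP => f; apply/eqP.
have /eqP : rscale c (a f) = 0 by rewrite -scalar_vNE -vNM ca.
rewrite /rscale scaler_eq0 => /orP[|//].
by rewrite eq_complex /= eqxx andbT (negbTE c0).
Qed.

Lemma common_multiple a b : a != 0 ->
  (forall f, b f = 0 -> f = 0) -> (forall x, x * b = 0 -> x = 0) ->
  exists s t, s * a = t * b /\ s * a != 0.
Proof.
move=> a0 b_inj b_rreg; apply: contrapT => nex.
have ab0 s t : s * a = t * b -> s * a = 0.
  move=> st; apply/eqP/negPn/negP => sa0; apply: nex.
  by exists s, t.
have [Ka [Ka0 aK]] := bounded_op_sqn (star a).
have [Kb [Kb0 bK]] := bounded_op_sqn (star b).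
(* |a^* x + b^* y|^2 is at most K (|x|^2 + |y|^2), the [+ 1] making [K] positive. Scaling [a] and
   [b] by K^(-1/2) therefore achieves [D_le]. *)
pose K := 2 * Ka + 2 * Kb + 1; have K0 : 0 < K by rewrite /K; lra.
pose c := (Num.sqrt K)^-1; have c0 : c != 0 by rewrite invr_eq0 gt_eqF ?sqrtr_gt0.
have cK : c ^+ 2 * K = 1 by rewrite exprVn sqr_sqrtr ?ltW// mulVf ?gt_eqF.
move/eqP: a0; apply; apply: (scalar_vN_eq0 c0).
have starc d : star (scalar_vN c * d) = star d * scalar_vN c.
  rewrite starM; congr (_ * _); apply: vN_eqP => f; apply: l2_eqP => h.
  by rewrite -starEr !scalar_vNE ipZl ipZr.
apply: (@contraction_common_multiple _ (scalar_vN c * b)) => [f|f|x|s t].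
- have E : (star (scalar_vN c * a) * (scalar_vN c * a)
           + star (scalar_vN c * b) * (scalar_vN c * b)) f
          = rscale (c ^+ 2) (star a (a f) + star b (b f)).
    rewrite !starc vND !vNM !scalar_vNE /rscale scalerDr !bounded_opZ !scalerA.
    by rewrite -!rmorphM /= -expr2.
  rewrite E ipZr ipDr -!starE !ipff sqnZ /abs2 /= expr0n addr0.
  have c20 : 0 <= c ^+ 2 by exact: sqr_ge0.
  rewrite expr2 -mulrA ler_wpM2l//.
  have H : sqn (star a (a f) + star b (b f)) <= K * (sqn (a f) + sqn (b f)).
    have := sqn_ge0 (star a (a f) - star b (b f)).
    rewrite sqnB sqnD /K; have := aK (a f); have := bK (b f).
    have := sqn_ge0 (a f); have := sqn_ge0 (b f); move: Ka0 Kb0.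
    by gen_atoms => *; nra.
  apply: le_trans (ler_wpM2l c20 H) _.
  by rewrite mulrA cK mul1r.
- rewrite vNM scalar_vNE /rscale => /eqP; rewrite scaler_eq0 => /orP[|/eqP/b_inj//].
  by rewrite eq_complex /= eqxx andbT (negbTE c0).
- rewrite mulrA => /b_rreg/(congr1 (@star R G)); rewrite starM star0.
  have -> : star (scalar_vN c) = scalar_vN c.
    by have := starc 1; rewrite mulr1 star1 mul1r.
  by move=> /(scalar_vN_eq0 c0)/(congr1 (@star R G)); rewrite starK star0.
- by rewrite !mulrA; exact: ab0.
Qed.

End CommonMultiple.

(** * Torsion chains *)

Section IntegralGroupRing.
Variables (R : realType) (G : groupType).
Local Notation l2 := (l2 R G).
Local Notation LG := (group_vN R G).
Local Notation u := (@vN_group_elt R G).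
Implicit Types (f : l2) (x y : LG) (g h : G).

(** The image of ZG in LG, presented by generators so that closure under products and adjoints
    follows by induction rather than by convolution in [malg]. *)
Inductive in_ZG : LG -> Prop :=
| in_ZG0 : in_ZG 0
| in_ZGB x y : in_ZG x -> in_ZG y -> in_ZG (x - y)
| in_ZGu g : in_ZG (u g).

Lemma in_ZGN x : in_ZG x -> in_ZG (- x).
Proof. by move=> xZ; rewrite -sub0r; exact: in_ZGB in_ZG0 xZ. Qed.

Lemma in_ZGD x y : in_ZG x -> in_ZG y -> in_ZG (x + y).
Proof. by move=> xZ yZ; rewrite -[y]opprK; exact: in_ZGB xZ (in_ZGN yZ). Qed.

Lemma vN_group_elt1 : u 1%g = 1.
Proof.
apply: vN_eqP => f; apply: l2_ext => x /=.
by rewrite /ltrans_fun invg1 mul1g.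
Qed.

Lemma in_ZG1 : in_ZG 1.
Proof. by rewrite -vN_group_elt1; exact: in_ZGu. Qed.

Lemma in_ZGM x y : in_ZG x -> in_ZG y -> in_ZG (x * y).
Proof.
move=> xZ yZ; elim: xZ => {x} [|x x' _ IHx _ IHx'|g].
- by rewrite mul0r; exact: in_ZG0.
- by rewrite mulrBl; exact: in_ZGB.
elim: yZ => {y} [|y y' _ IHy _ IHy'|h].
- by rewrite mulr0; exact: in_ZG0.
- by rewrite mulrBr; exact: in_ZGB.
by rewrite -vN_group_eltM; exact: in_ZGu.
Qed.

Lemma star_vN_group_elt g : star (u g) = u g^-1%g.
Proof.
apply: vN_eqP => f; apply: l2_eqP => h.
by rewrite -(starEr (u g)) ipC [RHS]ipC; exact: (ip_ltrans g h f).
Qed.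

Lemma in_ZG_star x : in_ZG x -> in_ZG (star x).
Proof.
elim=> {x} [|x y _ IHx _ IHy|g].
- by rewrite star0; exact: in_ZG0.
- by rewrite starB; exact: in_ZGB.
by rewrite star_vN_group_elt; exact: in_ZGu.
Qed.

Lemma group_ring_actE (D : {fset G}) (a : malg G int) f :
  (msupp a `<=` D)%fset ->
  group_ring_act a f = \sum_(g <- D) left_regular R g f *~ mcoeff g a.
Proof.
move=> aD; rewrite /group_ring_act [RHS](bigID (mem (msupp a))) /=.
rewrite [X in _ + X]big1 ?addr0; last first.
  by move=> g ga; rewrite mcoeff_outdom// mulr0z.
rewrite -[RHS]big_filter; apply: perm_big; apply: uniq_perm.
- exact: fset_uniq.
- by rewrite filter_uniq// fset_uniq.
by move=> g; rewrite mem_filter andb_idr// => /(fsubsetP aD).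
Qed.

Lemma group_ring_actB (a b : malg G int) f :
  group_ring_act a f - group_ring_act b f = group_ring_act (a - b) f.
Proof.
set D := (msupp (a - b)%R `|` (msupp a `|` msupp b))%fset.
have sD : [/\ msupp (a - b)%R `<=` D, msupp a `<=` D & msupp b `<=` D]%fset.
  by split; apply/fsubsetP => k kx; rewrite !inE kx ?orbT.
case: sD => s1 s2 s3; rewrite !(group_ring_actE _ s1) (group_ring_actE _ s2).
rewrite (group_ring_actE _ s3) -sumrB; apply: eq_bigr => g _.
by rewrite mcoeffB mulrzBr.
Qed.

Lemma in_ZG_act x : in_ZG x -> exists a : malg G int, forall f,
  x f = group_ring_act a f.
Proof.
elim=> {x} [|x y _ [a xa] _ [b yb]|g].
- by exists 0 => f; rewrite /group_ring_act msupp0 big_nil.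
- by exists (a - b) => f; rewrite -group_ring_actB -xa -yb.
exists (mkmalgU g 1) => f.
by rewrite (@group_ring_actE [fset g]%fset) ?msuppU_le// big_seq_fset1 mcoeffUU.
Qed.

Hypothesis act_injective : forall a : malg G int, a != 0 ->
  injective (@group_ring_act R G a).

Lemma in_ZG_inj x f : in_ZG x -> x != 0 -> x f = 0 -> f = 0.
Proof.
move=> /in_ZG_act[a xa] x0 xf; have [a0|/act_injective] := eqVneq a 0.
  case/eqP: x0; apply: vN_eqP => h.
  by rewrite xa a0 /group_ring_act msupp0 big_nil.
by apply; rewrite -!xa xf bounded_op0.
Qed.

(** Passing to adjoints turns this into injectivity of [star x], again a non-zero element of ZG. *)
Lemma in_ZG_rreg x y : in_ZG x -> x != 0 -> y * x = 0 -> y = 0.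
Proof.
move=> /in_ZG_star xZ x0 yx; rewrite -[y]starK -star0; congr star.
apply: vN_eqP => f; apply: (in_ZG_inj xZ).
  by apply: contra x0 => /eqP/(congr1 (@star R G)); rewrite starK star0 => ->.
by rewrite -vNM -starM yx star0.
Qed.

Definition essential (I : set LG) := forall r, r != 0 ->
  exists x, x * r != 0 /\ I (x * r).

(* [b] becomes invertible in the maximal ring of quotients of LG *)
Definition regular b := (forall x, x * b = 0 -> x = 0) /\
  essential [set s | exists t, s = t * b].

Lemma in_ZG_regular b : in_ZG b -> b != 0 -> regular b.
Proof.
move=> bZ b0; split=> [x|r r0]; first exact: in_ZG_rreg.
have [|x|s [t [st sr0]]] := @common_multiple R G r b r0.
- by move=> f; exact: in_ZG_inj.
- exact: in_ZG_rreg.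
by exists s; split=> //; exists t.
Qed.

End IntegralGroupRing.

(* Stated over an abstract ring because rewriting in the free LG-module is
   slow *)
Lemma scale_split (A : pzRingType) (M : lmodType A) (x s b e : A) (c c' g : M) :
  x *: (s *: (c + c') - b *: g) =
  ((x * s) *: c - e *: g) + ((x * s) *: c' - (x * b - e) *: g).
Proof.
rewrite scalerBr !scalerA scalerDr scalerBl opprB addrACA [- _ + _]addrA.
by rewrite addNr add0r.
Qed.

Lemma scale_diff (A : pzRingType) (M : lmodType A) (x s b : A) (c g : M) :
  x *: (s *: c - b *: g) = (x * s) *: c - (x * b) *: g.
Proof. by rewrite scalerBr !scalerA. Qed.

Lemma scale_diff_via (A : pzRingType) (M : lmodType A) (x s b e : A) (c k g : M) :
  x *: (s *: c - b *: g) =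
  ((x * s) *: c - e *: k) + (e *: k - (x * b) *: g).
Proof. by rewrite scale_diff subrKA. Qed.

(** * Torsion modulo boundaries, and the subgroups D_h *)

Section SingularTorsion.
Variables (R : realType) (G : groupType).
Local Notation LG := (group_vN R G).
Local Notation u := (@vN_group_elt R G).
Local Notation C1 := (malg G LG).
Implicit Types (x y r s t b v : LG) (c : C1) (g h k : G) (I J : set LG).

Lemma essential_quot I x : (forall y s, I s -> I (y * s)) -> essential I ->
  essential [set s | I (s * x)].
Proof.
move=> IM Iess r r0; have [rx0|rx0] := eqVneq (r * x) 0.
  exists 1; rewrite mul1r; split=> //=.
  (* Essentiality at 1 provides an element of [I], and multiplying it by 0 shows that [I] contains
     0. *)
  by have [y [_ /(IM 0)]] := Iess 1 (oner_neq0 _); rewrite mul0r rx0.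
have [y [yr0 Iy]] := Iess _ rx0; exists y; split=> /=; last by rewrite -mulrA.
by apply: contra yr0 => /eqP yr; rewrite mulrA yr mul0r.
Qed.

(* [LG v^*] meets the left annihilator of [v] trivially, so LG is
   nonsingular *)
Lemma nonsingular I v : essential I -> (forall s, I s -> s * v = 0) -> v = 0.
Proof.
move=> Iess Iv; apply/eqP/negPn/negP => v0.
have sv0 : star v != 0.
  by apply: contra v0 => /eqP/(congr1 (@star R G)); rewrite starK star0 => ->.
have [x [xv0 /Iv xvv]] := Iess _ sv0; case/eqP: xv0.
rewrite -[LHS]starK -star0; congr star; apply: star_mul_eq0.
by rewrite starK starM starK mulrA xvv mul0r.
Qed.

Definition boundary c := exists e, bar_d2 e = c.

Lemma boundary0 : boundary 0.
Proof. by exists 0; exact: linear0. Qed.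

Lemma boundaryD c c' : boundary c -> boundary c' -> boundary (c + c').
Proof. by move=> [e <-] [e' <-]; exists (e + e'); exact: linearD. Qed.

Lemma boundaryZ s c : boundary c -> boundary (s *: c).
Proof. by move=> [e <-]; exists (s *: e); exact: linearZ. Qed.

Lemma bar_d1D c c' : bar_d1 (c + c') = bar_d1 c + bar_d1 c'.
Proof. exact: linearD. Qed.

Lemma bar_d1Z s c : bar_d1 (s *: c) = s * bar_d1 c.
Proof. exact: linearZ. Qed.

Lemma bar_d1_boundary c : boundary c -> bar_d1 c = 0.
Proof. by move=> [e <-]; exact: bar_d1_d2. Qed.

Definition gen g : C1 := mkmalgU g 1.

Lemma bar_d1_gen g : bar_d1 (gen g) = u g - 1.
Proof. by rewrite /gen bar_d1U mul1r. Qed.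

Lemma scale_gen s g : s *: gen g = mkmalgU g s.
Proof. by apply/malgP => k; rewrite mcoeffZ !mcoeffU mulrnAr mulr1. Qed.

Lemma boundary_gen g h : boundary (u g *: gen h - gen (g * h)%g + gen g).
Proof.
exists (mkmalgU (g, h) 1); rewrite scale_gen.
by rewrite -[RHS]scale1r; exact: malg_liftU.
Qed.

Lemma boundary_gen1 : boundary (gen 1%g).
Proof.
have := boundary_gen 1%g 1%g.
by rewrite mulg1 vN_group_elt1 scale1r subrr add0r.
Qed.

(** The class of [c] in C1 / B1 lies in the singular submodule. *)
Definition torsion c := essential [set s | boundary (s *: c)].

Lemma torsion_ideal c y s : boundary (s *: c) -> boundary ((y * s) *: c).
Proof. by rewrite -scalerA; exact: boundaryZ. Qed.

Lemma torsion_boundary c : boundary c -> torsion c.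
Proof.
move=> cB r r0; exists 1; rewrite mul1r; split; first exact: r0.
exact: boundaryZ cB.
Qed.

Lemma torsionZ s c : torsion c -> torsion (s *: c).
Proof.
move=> cT r r0.
have [y [yr0 yB]] := essential_quot s (@torsion_ideal c) cT r0.
exists y; split; first exact: yr0.
by rewrite /= scalerA; exact: yB.
Qed.

Lemma torsionD c c' : torsion c -> torsion c' -> torsion (c + c').
Proof.
move=> cT cT' r r0; have [x [xr0 xB]] := cT r r0.
have [y [yxr0 yB]] := cT' (x * r) xr0; exists (y * x).
rewrite -mulrA; split; first exact: yxr0.
rewrite /= scalerDr; apply: boundaryD; last exact: yB.
exact: torsion_ideal xB.
Qed.

(** Dividing out torsion leaves no new torsion. If no multiple of [x * r] worked for [r], the
    essential annihilator of [(x * r) *: c] would kill [x * r], against nonsingularity. *)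
Lemma torsion_essential J c : essential J -> (forall s, J s -> torsion (s *: c)) ->
  torsion c.
Proof.
move=> Jess Jc r r0; have [x [xr0 /Jc xrT]] := Jess _ r0.
apply: contrapT => nex; case/eqP: xr0; apply: (nonsingular xrT) => s /= sB.
apply/eqP/negPn/negP => sxr0; apply: nex; exists (s * x); rewrite -mulrA.
by split; [exact: sxr0|rewrite /= -scalerA; exact: sB].
Qed.

(* After inverting [u h - 1] in the module C1 / B1, [agree h] consists of the
   chains [c] with [c = d1 c * (u h - 1)^-1 * h]. *)
Definition agree h c := forall s b,
  s * bar_d1 c = b * (u h - 1) -> torsion (s *: c - b *: gen h).

Section Agree.
Variable h : G.
Hypothesis h_regular : regular (u h - 1).

(** The fraction x (u h - 1)^-1 has an essential ideal of denominators; with [torsion_essential] one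
    may always clear them. *)
Lemma essential_divisible x : essential [set s | exists t, s * x = t * (u h - 1)].
Proof.
apply: (essential_quot x _ h_regular.2) => y s [t ->].
by exists (y * t); rewrite mulrA.
Qed.

Lemma agree_boundary c : boundary c -> agree h c.
Proof.
move=> cB s b; rewrite bar_d1_boundary// mulr0 => /esym/h_regular.1 ->.
by rewrite scale0r subr0; apply/torsion_boundary/boundaryZ.
Qed.

Lemma agreeZ r c : agree h c -> agree h (r *: c).
Proof. by move=> ch s b; rewrite bar_d1Z mulrA scalerA => /ch. Qed.

Lemma agreeD c c' : agree h c -> agree h c' -> agree h (c + c').
Proof.
(* Only the sum of the two differentials is known to be divisible by [u h - 1]. After multiplication
   by [x] the first is divisible alone, hence so is the second. *)
move=> ch ch' s b E; apply: (torsion_essential (essential_divisible (s * bar_d1 c))).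
move=> x [e xe]; have E' : x * s * bar_d1 c' = (x * b - e) * (u h - 1).
  by rewrite mulrBl -[x * b * _]mulrA -E -xe bar_d1D !mulrDr !mulrA addrC addKr.
have T1 : torsion ((x * s) *: c - e *: gen h) by apply: ch; rewrite -mulrA.
have T2 := ch' _ _ E'; have := torsionD T1 T2.
by rewrite -(scale_split x s b e c c' (gen h)).
Qed.

Lemma agreeN c : agree h c -> agree h (- c).
Proof. by rewrite -scaleN1r; exact: agreeZ. Qed.

Lemma agreeB c c' : agree h c -> agree h c' -> agree h (c - c').
Proof. by move=> ch /agreeN; exact: agreeD. Qed.

Lemma agree_gen : agree h (gen h).
Proof.
move=> s b; rewrite bar_d1_gen => /eqP; rewrite -subr_eq0 -mulrBl.
move=> /eqP/h_regular.1/eqP; rewrite subr_eq0 => /eqP->; rewrite subrr.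
by apply: torsion_boundary; exact: boundary0.
Qed.

Lemma agree_regular r c : regular r -> agree h (r *: c) -> agree h c.
Proof.
move=> [_ r_ess] rch s b E.
have IM y t : (exists e, t = e * r) -> exists e, y * t = e * r.
  by move=> [e ->]; exists (y * e); rewrite mulrA.
apply: (torsion_essential (essential_quot s IM r_ess)) => x [e xe].
have E' : e * bar_d1 (r *: c) = x * b * (u h - 1).
  by rewrite bar_d1Z mulrA -xe -!mulrA E.
by rewrite (scale_diff x s b c (gen h)) xe -(scalerA e r c); exact: rch.
Qed.

Lemma agree_gen1 : agree h (gen 1%g).
Proof. exact: agree_boundary boundary_gen1. Qed.

(** The cocycle rule d(g k) = d(g) + g d(k) holds modulo boundaries; with [agree_gen1] and
    [agree_genV] it makes D_h a subgroup. *)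
Lemma agree_genM g k : agree h (gen g) -> agree h (gen k) ->
  agree h (gen (g * k)%g).
Proof.
move=> gh kh; have E := agree_boundary (boundary_gen g k).
have := agreeB (agreeD (agreeZ (r := u g) kh) gh) E; congr agree.
by apply/eqP; rewrite subr_eq addrA [gen _ + _]addrC subrK.
Qed.

Lemma agree_genV g : agree h (gen g) -> agree h (gen g^-1%g).
Proof.
move=> gh; have E := agree_boundary (boundary_gen g^-1%g g).
have := agreeD (agreeB E (agreeZ (r := u g^-1%g) gh)) agree_gen1; congr agree.
rewrite mulVg (addrAC (_ *: _) (- _) (gen _)) (addrAC _ _ (gen 1%g)) subrK.
by rewrite addrC addKr.
Qed.

End Agree.

(** After clearing denominators, [c] is replaced by a multiple of [gen k] and this by a multiple of
    [gen h]. Together with [agree_sym] it shows that each non-trivial element of D_h determines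
    D_h. *)
Lemma agree_trans h k c : regular (u h - 1) -> regular (u k - 1) ->
  agree h (gen k) -> agree k c -> agree h c.
Proof.
move=> hreg kreg hk kc s b E.
apply: (torsion_essential (essential_divisible kreg (s * bar_d1 c))).
move=> x [e xe].
have T1 : torsion ((x * s) *: c - e *: gen k) by apply: kc; rewrite -mulrA.
have T2 : torsion (e *: gen k - (x * b) *: gen h).
  by apply: hk; rewrite bar_d1_gen -xe E mulrA.
by have := torsionD T1 T2; rewrite -(scale_diff_via x s b e c (gen k) (gen h)).
Qed.

Lemma agree_sym h k : regular (u h - 1) -> regular (u k - 1) ->
  agree h (gen k) -> agree k (gen h).
Proof.
move=> hreg kreg hk s b; rewrite bar_d1_gen => /esym E.
have := hk b s; rewrite bar_d1_gen => /(_ E)/(torsionZ (- 1)).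
by rewrite scaleN1r opprB.
Qed.

Lemma agree_cycle_torsion h c : regular (u h - 1) ->
  (forall g, agree h (gen g)) -> bar_d1 c = 0 -> torsion c.
Proof.
move=> hreg hgen c0; have hc : agree h c.
  rewrite (monalgE c); elim: (enum_fset (msupp c)) => [|g s IHs].
    by rewrite big_nil; apply: agree_boundary => //; exact: boundary0.
  rewrite big_cons; apply: agreeD => //.
  have -> : mkmalgU g (mcoeff g c) = mcoeff g c *: gen g.
    by rewrite scale_gen.
  exact: agreeZ.
(* For a cycle the vector d1 c (u h - 1)^-1 h is 0, so agreement with [h] is torsion. *)
have := hc 1 0; rewrite c0 mulr0 mul0r scale0r scale1r subr0.
exact.
Qed.

End SingularTorsion.

(** * Relations in free products *)

Section FreeProductWords.
Variables A B : groupType.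
Local Notation word := (seq (A + B)).
Implicit Types (v w : word).

Definition is_inl (x : A + B) := if x is inl _ then true else false.

Lemma fp_eq_catl u v w : fp_eq v w -> fp_eq (u ++ v) (u ++ w).
Proof. by move=> vw; apply: fp_eq_cat => //; exact: fp_eq_refl. Qed.

Lemma fp_eq_catr u v w : fp_eq v w -> fp_eq (v ++ u) (w ++ u).
Proof. by move=> vw; apply: fp_eq_cat => //; exact: fp_eq_refl. Qed.

Variables (H : groupType) (f : {multiplicative A -> H}).
Variable g : {multiplicative B -> H}.
Local Notation ev := (fp_word_eval f g).

Lemma fp_word_eval_nil : ev [::] = 1%g.
Proof. exact: big_nil. Qed.

Lemma fp_word_eval_cat v w : ev (v ++ w) = (ev v * ev w)%g.
Proof. exact: big_cat. Qed.

Lemma fp_word_eval_inv w : ev (fp_word_inv w) = (ev w)^-1%g.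
Proof.
apply: (mulgI (ev w)); rewrite -fp_word_eval_cat mulgV -fp_word_eval_nil.
exact/fp_word_eval_eq/fp_eq_mulV.
Qed.

Definition relation w := ev w = 1%g /\ ~ fp_eq w [::].

Lemma relation_of_not_injective : ~ injective (fp_lift f g) -> exists w, relation w.
Proof.
move=> ninj; apply: contrapT => norel; apply: ninj.
elim/quotW => v; elim/quotW => w; rewrite !fp_lift_pi => vw.
apply/fp_piP/asboolP; apply: contrapT => nvw; apply: norel.
exists (v ++ fp_word_inv w); split.
  by rewrite fp_word_eval_cat fp_word_eval_inv vw mulgV.
move=> vw1; apply: nvw; have := fp_eq_catr w vw1; rewrite -catA.
apply: fp_eq_trans; rewrite -{1}[v]cats0; apply/fp_eq_catl/fp_eq_sym.
by rewrite -{2}[w]fp_word_invK; exact: fp_eq_mulV.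
Qed.

Section Minimal.
Variable w : word.
Hypotheses (w_rel : relation w)
  (w_min : forall v, relation v -> (size w <= size v)%N).

Let trivial_of_short v : (size v < size w)%N -> ev v = 1%g -> fp_eq v [::].
Proof.
move=> vw v1; apply: contrapT => nv; have := w_min (conj v1 nv).
by rewrite leqNgt vw.
Qed.

Let no_shortening v : (size v < size w)%N -> ~ fp_eq w v.
Proof.
move=> vw wv; case: (w_rel) => w1 []; apply: (fp_eq_trans wv).
by apply: trivial_of_short => //; rewrite -(fp_word_eval_eq f g wv).
Qed.

(** Equal values would make the factor between the two prefixes a shorter word of value 1, trivial
    by minimality, and deleting it would shorten [w]. The second condition excludes the factor [w]
    itself. *)
Lemma minimal_prefix_neq i j : (i < j <= size w)%N ->
  (0 < i)%N || (j < size w)%N ->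
  ev (take i w) != ev (take j w).
Proof.
move=> /andP[ij jw] proper; apply/eqP => E.
have Ew : w = take i w ++ drop i (take j w) ++ drop j w.
  by rewrite catA -{1}(take_takel w (ltnW ij)) !cat_take_drop.
apply: (@no_shortening (take i w ++ drop j w)).
  by rewrite size_cat size_drop size_takel; lia.
rewrite {1}Ew; apply: fp_eq_catl; rewrite -[drop j w in X in fp_eq _ X]cat0s.
apply/fp_eq_catr/trivial_of_short.
  by rewrite size_drop size_takel//; lia.
apply: (mulgI (ev (take i w))); rewrite mulg1 {2}E -fp_word_eval_cat.
by rewrite -(take_takel w (ltnW ij)) cat_take_drop.
Qed.

(** Adjacent letters from one factor could be merged, and a one-letter relation is trivial because
    the factors embed. *)
Lemma minimal_alternating : injective f -> injective g ->
  exists x y v, w = x :: y :: v /\ is_inl x != is_inl y.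
Proof.
move=> f_inj g_inj; case: (w_rel) => w1 w_nil.
case Ew : w w1 w_nil => [|x [|y v]] w1 w_nil.
- by case: w_nil; exact: fp_eq_refl.
- case: w_nil; move: w1; rewrite /fp_word_eval big_seq1.
  case: x {Ew} => [a|b]; rewrite -1?(multiplicative1 f) -1?(multiplicative1 g).
    by move=> /f_inj->; exact: fp_eq_inl1.
  by rewrite (multiplicative1 f) -(multiplicative1 g) => /g_inj->; exact: fp_eq_inr1.
exists x, y, v; split=> //; case: x y Ew {w1 w_nil} => [a|a] [b|b] //= Ew; exfalso.
  apply: (@no_shortening (inl (a * b)%g :: v)); first by rewrite Ew /= ltnS.
  by rewrite Ew; exact: (fp_eq_catr v (fp_eq_inlM _ a b)).
apply: (@no_shortening (inr (a * b)%g :: v)); first by rewrite Ew /= ltnS.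
by rewrite Ew; exact: (fp_eq_catr v (fp_eq_inrM _ a b)).
Qed.

End Minimal.

Lemma minimal_relation : ~ injective (fp_lift f g) -> exists w,
  relation w /\ forall v, relation v -> (size w <= size v)%N.
Proof.
move=> /relation_of_not_injective[w0 w0_rel].
pose P n := `[< exists w, relation w /\ size w = n >].
have exP : exists n, P n by exists (size w0); apply/asboolP; exists w0.
have [_ /asboolP[w [w_rel <-]] w_min] := ex_minnP exP.
by exists w; split=> // v v_rel; apply: w_min; apply/asboolP; exists v.
Qed.

End FreeProductWords.

Section CanonicalHom.
Variable G : groupType.
Implicit Types (g f : G).

Lemma generated_ind (X P : set G) : P 1%g ->
  (forall x y, P x -> P y -> P (x * y^-1)%g) ->
  X `<=` P -> generated X `<=` P.
Proof.
move=> P1 PV XP x; apply; split=> //; split; first exact/mem_set.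
by move=> y z /set_mem Py /set_mem Pz; apply/mem_set/PV.
Qed.

Lemma mem_generated (X : set G) x : X x -> x \in in_generated X.
Proof. by move=> Xx; apply/mem_set => K [_]; exact. Qed.

Definition gen_elt g : subgroup_gen [set g] :=
  SubgroupGen (mem_generated (erefl : [set g] g)).

Variables g f : G.
Local Notation word := (seq (subgroup_gen [set g] + subgroup_gen [set f])).

Local Notation fp := (freeprod (subgroup_gen [set g]) (subgroup_gen [set f])).

Definition letter (x : subgroup_gen [set g] + subgroup_gen [set f]) : G :=
  match x with inl a => subgroup_gen_val a | inr b => subgroup_gen_val b end.

Definition word_val (w : word) : G := (\prod_(x <- w) letter x)%g.

Local Notation incl_l := (subgroup_incl (@sub_set1l _ g f)).
Local Notation incl_r := (subgroup_incl (@sub_set1r _ g f)).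

Lemma word_valE w : word_val w = subgroup_gen_val (fp_word_eval incl_l incl_r w).
Proof.
elim: w => [|x w IHw]; first by rewrite /word_val /fp_word_eval !big_nil.
rewrite /word_val /fp_word_eval !big_cons -/(word_val w) IHw.
by case: x.
Qed.

Lemma canonical_hom_pi w :
  subgroup_gen_val (canonical_hom (\pi_fp w)) = word_val w.
Proof. by rewrite word_valE -fp_lift_pi. Qed.

Lemma canonical_hom_surj (y : subgroup_gen [set g; f]) :
  exists x, @canonical_hom G g f x = y.
Proof.
suff [w wy] : exists w, word_val w = subgroup_gen_val y.
  by exists (\pi_fp w); apply/val_inj; rewrite /= canonical_hom_pi.
have /set_mem : subgroup_gen_val y \in generated [set g; f] by exact: (valP y).
apply: (@generated_ind _ (fun z => exists w, word_val w = z)).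
- by exists [::]; rewrite /word_val big_nil.
- move=> _ _ [v <-] [w <-]; exists (v ++ fp_word_inv w).
  by rewrite !word_valE fp_word_eval_cat fp_word_eval_inv.
- by move=> _ [->|->]; [exists [:: inl (gen_elt g)]|exists [:: inr (gen_elt f)]];
    rewrite /word_val big_seq1.
Qed.

Lemma free_fromP : free_from g f <-> injective (@canonical_hom G g f).
Proof.
split=> [|inj]; first exact: bij_inj.
have ex y := cid (canonical_hom_surj y).
exists (fun y => sval (ex y)) => x; last by case: (ex x).
by apply: inj; case: (ex _).
Qed.

Lemma minimal_word : ~ free_from g f -> exists x y v,
  [/\ is_inl x != is_inl y, word_val (x :: y :: v) = 1%g &
    forall i, (i <= (size v).+2)%N -> i != 1%N ->
      word_val (take i (x :: y :: v)) != letter x].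
Proof.
move=> nfree; have ninj : ~ injective (fp_lift incl_l incl_r).
  by move=> inj; apply: nfree; apply/free_fromP.
have [w [w_rel w_min]] := minimal_relation ninj.
have incl_inj X Y (XY : X `<=` Y) : injective (@subgroup_incl G X Y XY).
  by move=> a b /(congr1 val) /= ab; apply: val_inj.
have [x [y [v [Ew xy]]]] :=
  minimal_alternating w_rel w_min (incl_inj _ _ _) (incl_inj _ _ _).
exists x, y, v; rewrite -Ew; split=> // [|i iw i1].
  by rewrite word_valE w_rel.1.
have -> : letter x = word_val (take 1 w) by rewrite Ew /word_val /= ?take0 big_seq1.
rewrite !word_valE; apply/eqP => /(@val_inj _ _ (subgroup_gen [set g; f])) E.
have sw : size w = (size v).+2 by rewrite Ew.
case: i iw i1 E => [|[//|i]] iw _ E.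
  have := @minimal_prefix_neq _ _ _ _ _ _ w_rel w_min 0 1.
  by rewrite sw E eqxx => /(_ erefl erefl).
have := @minimal_prefix_neq _ _ _ _ _ _ w_rel w_min 1 i.+2.
by rewrite sw E eqxx => /(_ iw erefl).
Qed.

End CanonicalHom.

(** * Fox calculus *)

Lemma fox_div (A : pzRingType) (M : lmodType A) (s c d : A) (x y z k : M) :
  (s *: y - x + z) + (x - c *: k) + (- s) *: (y - d *: k)
  = z - (c - s * d) *: k.
Proof.
rewrite scaleNr scalerBr scalerA scalerBl !opprB [_ - x + z]addrAC.
rewrite [_ - x + _]addrA subrK -[s *: y + z - _]addrA addrC.
by rewrite [(s * d) *: k - _]addrC addrA addrK addrAC addrA.
Qed.

Lemma fox_cons (A : pzRingType) (M : lmodType A) (s a b : A) (x y z t k l : M) :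
  -1 *: (s *: x - y + z) + (z - t) + s *: (x - (a *: k + b *: l))
  = y - (t + ((s * a) *: k + (s * b) *: l)).
Proof.
rewrite scaleN1r opprD opprB [_ - z + _]addrA subrK scalerBr scalerDr !scalerA.
by rewrite [y - _ - t]addrAC [_ - s *: x + _]addrA subrK [in RHS]opprD addrA.
Qed.

Lemma scale_subK (A : pzRingType) (M : lmodType A) (x y : M) :
  y + -1 *: (y - x) = x.
Proof. by rewrite scaleN1r subKr. Qed.

Section FoxCalculus.
Variables (R : realType) (G : groupType).
Local Notation l2 := (l2 R G).
Local Notation LG := (group_vN R G).
Local Notation u := (@vN_group_elt R G).
Local Notation C1 := (malg G LG).
Local Notation gen := (@gen R G).
Variables g f : G.
Local Notation alphabet := (subgroup_gen [set g] + subgroup_gen [set f])%type.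
Implicit Types (x y : alphabet) (w v : seq alphabet).

(** Letters are arbitrary elements of a cyclic group, so the Fox derivative of a power is needed; it
    follows from d(a b^-1) = d(a) - a b^-1 d(b). *)
Lemma boundary_gen_cyclic k z : generated [set k] z ->
  exists2 c, in_ZG c & boundary (gen z - c *: gen k).
Proof.
apply: (@generated_ind _ _
  (fun z => exists2 c, in_ZG c & boundary (gen z - c *: gen k))).
- by exists 0; [exact: in_ZG0|rewrite scale0r subr0; exact: boundary_gen1].
- move=> a b [c cZ cB] [d dZ dB].
  exists (c - u (a * b^-1)%g * d).
    by apply: in_ZGB => //; apply: in_ZGM => //; exact: in_ZGu.
  have E1 := boundary_gen R (a * b^-1)%g b; rewrite mulgVK in E1.
  have := boundaryD (boundaryD E1 cB) (boundaryZ (- u (a * b^-1)%g) dB).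
  congr boundary; exact: fox_div.
- by move=> _ ->; exists 1; [exact: in_ZG1|rewrite scale1r subrr; exact: boundary0].
Qed.

(* The sum of [p_i - p_(i-1)] over the positions [i] of the letters from <g>,
   where [p_i] is the value of the prefix of length [i]; it equals
   [(dw/dg) * (g - 1)] for the Fox derivative [dw/dg]. *)
Fixpoint fox_sum w : LG :=
  if w is x :: w' then
    (if is_inl x then u (letter x) - 1 else 0) + u (letter x) * fox_sum w'
  else 0.

Lemma fox_sum_cons x w : fox_sum (x :: w) =
  (if is_inl x then u (letter x) - 1 else 0) + u (letter x) * fox_sum w.
Proof. by []. Qed.

Lemma fox_derivative w : exists a b, [/\ in_ZG a, in_ZG b,
  boundary (gen (word_val w) - (a *: gen g + b *: gen f)) &
  a * (u g - 1) = fox_sum w].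
Proof.
elim: w => [|x w [a [b [aZ bZ abB aE]]]].
  exists 0, 0; split; [exact: in_ZG0|exact: in_ZG0| |by rewrite mul0r].
  rewrite !scale0r addr0 subr0 /word_val big_nil.
  exact: boundary_gen1.
have E1 := boundary_gen R (letter x) (word_val w).
have Ew : word_val (x :: w) = (letter x * word_val w)%g by rewrite /word_val big_cons.
have uZ k : in_ZG (u k) by exact: in_ZGu.
case: x E1 Ew => z /= E1 Ew.
  have /boundary_gen_cyclic[c cZ cB] : generated [set g] (val z).
    by have /set_mem := (valP z).
  exists (c + u (val z) * a), (u (val z) * b); split.
  - by apply: in_ZGD => //; exact: in_ZGM.
  - exact: in_ZGM.
  - rewrite Ew.
    have := boundaryD (boundaryD (boundaryZ (-1) E1) cB) (boundaryZ (u (val z)) abB).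
    by rewrite fox_cons scalerDl addrA.
  - rewrite mulrDl -mulrA aE; congr (_ + _).
    (* Applying [bar_d1] to the boundary for one letter gives c (g - 1) = z - 1, the contribution of
       that letter to [fox_sum]. *)
    have := bar_d1_boundary cB; rewrite -scaleNr bar_d1D bar_d1Z !bar_d1_gen mulNr.
    by move/eqP; rewrite subr_eq0 => /eqP.
have /boundary_gen_cyclic[c cZ cB] : generated [set f] (val z).
  by have /set_mem := (valP z).
exists (u (val z) * a), (c + u (val z) * b); split.
- exact: in_ZGM.
- by apply: in_ZGD => //; exact: in_ZGM.
- rewrite Ew.
  have := boundaryD (boundaryD (boundaryZ (-1) E1) cB) (boundaryZ (u (val z)) abB).
  by rewrite fox_cons scalerDl [in X in _ -> X]addrCA.
- by rewrite -mulrA aE add0r.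
Qed.

Lemma u_delta k z : (u k (delta R 1%g)) z = (z == k)%:R.
Proof.
rewrite /= /ltrans_fun /=; congr (nat_of_bool _)%:R.
by apply/eqP/eqP => [/(congr1 (fun t => k * t)%g)|->]; rewrite ?mulVg// mulVKg mulg1.
Qed.

(** [fox_sum] is supported on prefix values; [k] accumulates the part of the word already read. *)
Lemma fox_sum_coef0 w k z :
  (forall i, (i <= size w)%N -> z != (k * word_val (take i w))%g) ->
  ((u k * fox_sum w) (delta R 1%g)) z = 0.
Proof.
elim: w k => [|x w IHw] k zk; first by rewrite [fox_sum _]/(0 : LG) mulr0.
have zk0 : z != k by have := zk 0%N isT; rewrite /word_val take0 big_nil mulg1.
have zk1 : z != (k * letter x)%g.
  by have := zk 1%N isT; rewrite /= ?take0 /word_val big_seq1.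
rewrite fox_sum_cons mulrDr vND l2D mulrA -vN_group_eltM IHw ?addr0; last first.
  by move=> i iw; have := zk i.+1 iw; rewrite /= /word_val big_cons mulgA.
case: (is_inl x); last by rewrite mulr0.
rewrite mulrBr mulr1 -vN_group_eltM vND vNN l2D l2N !u_delta.
by rewrite (negbTE zk0) (negbTE zk1) subrr.
Qed.

(* For a relation of minimal length the proper prefixes have distinct values and
   the first two letters lie in different factors, so the value of the first
   letter occurs exactly once in [fox_sum]. *)
Lemma fox_relation : ~ free_from g f -> exists a b, [/\ in_ZG a, in_ZG b,
  boundary (a *: gen g + b *: gen f) & a * (u g - 1) != 0].
Proof.
move=> /minimal_word[x [y [v [xy w1 wx]]]].
have [a [b [aZ bZ]]] := fox_derivative (x :: y :: v); rewrite w1 => abB aE.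
exists a, b; split=> //.
  by have := boundaryD (boundary_gen1 R G) (boundaryZ (- 1) abB); rewrite scale_subK.
apply/eqP => /(congr1 (fun t : LG => t (delta R 1%g) (letter x))).
have x1 : letter x != 1%g.
  by have := wx 0%N isT isT; rewrite /word_val /= big_nil eq_sym.
have xy1 : letter x != (letter x * letter y)%g.
  have := wx 2%N isT isT; rewrite /word_val /= ?take0 !big_cons big_nil mulg1.
  by rewrite eq_sym.
rewrite aE !fox_sum_cons mulrDr mulrA -vN_group_eltM !vND !l2D.
rewrite fox_sum_coef0; last first.
  move=> i iv; have := wx i.+2 iv isT; rewrite /word_val /= !big_cons mulgA.
  by rewrite eq_sym.
have two k : (u k - 1) (delta R 1%g) (letter x)
    = (letter x == k)%:R - (letter x == 1%g)%:R.
  by rewrite vND vNN l2D l2N -vN_group_elt1 !u_delta.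
(* The coefficient is 1, from p_1 - p_0, if the first letter lies in <g>, and -1, from p_2 - p_1, if
   the second does. *)
case: (is_inl x) (is_inl y) xy => [] [] // _.
  by rewrite mulr0 two eqxx (negbTE x1) subr0 !addr0 => /eqP; rewrite oner_eq0.
rewrite mulrBr mulr1 -vN_group_eltM vND vNN l2D l2N !u_delta.
by rewrite (negbTE xy1) eqxx !add0r addr0 => /eqP; rewrite oppr_eq0 oner_eq0.
Qed.

End FoxCalculus.

(** * The first Betti number *)

Section NonTorsionCycle.
Variables (R : realType) (G : groupType).
Local Notation LG := (group_vN R G).
Local Notation C1 := (malg G LG).
Local Notation Hq := (quotmod (@is_boundary1 R G)).

Hypothesis cycles_torsion : forall c : C1, bar_d1 c = 0 -> torsion c.

(** The image of a row [v] of LG^n A is the class of a torsion cycle, so by injectivity an essential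
    set of scalars kills [v], and nonsingularity gives [v = 0]. *)
Lemma fg_projective0 (P : set (H1 R G)) n (A : 'M[LG]_n) :
  fg_projective P A -> A = 0.
Proof.
move=> [_ [f [_ f_inj _]]].
have im_eq0 (w : 'rV[LG]_n) : w *m A = 0.
  set v := w *m A; apply/matrixP => i j; rewrite [RHS]mxE.
  have [z zE] : exists z : cycle1 R G, \pi_Hq z = f v.
    by exists (repr (f v)); rewrite reprK.
  have /cycles_torsion zT : bar_d1 (z : C1) = 0 by apply/eqP; exact: (valP z).
  apply: (nonsingular zT) => s [e sE].
  suff sv0 : s *: v = 0 by have := congr1 (fun m : 'rV_n => m i j) sv0; rewrite !mxE.
  apply: f_inj; [by apply/mem_set; exists (s *: w) => //; rewrite scalemxAl| |].
    by apply/mem_set; exists 0 => //; rewrite mul0mx.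
  rewrite linear0 linearZ /= -zE.
  have -> : s *: (\pi_Hq z) = \pi_Hq (s *: z) by exact: pi_quotmodZ.
  rewrite -[RHS](raddf0 \pi_Hq).
  by apply/quotmod_piP; rewrite subr0; apply/asboolP; exists e.
apply/row_matrixP => i; rewrite row0 -[RHS](im_eq0 (delta_mx 0 i)).
by rewrite rowE.
Qed.

Lemma betti1_eq0 : l2_betti1 R G = 0%E.
Proof.
rewrite /l2_betti1 /luck_dim.
suff -> : [set d | exists (P : set (H1 R G)) n (A : 'M[LG]_n),
    fg_projective P A /\ d = (projective_dim A)%:E] = [set 0%E].
  exact: ereal_sup1.
have dim0 n : projective_dim (0 : 'M[LG]_n) = 0.
  by rewrite /projective_dim mxtrace0 /vN_trace.
apply/seteqP; split=> [_ [P [n [A [/fg_projective0-> ->]]]]|_ ->].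
  by rewrite dim0.
(* The empty matrix realizes dimension 0, so the supremum is 0 and not that of the empty set. *)
exists [set 0], 0%N, 0; split; last by rewrite dim0.
split; first by rewrite mul0mx.
exists (\0 : {linear 'rV[LG]_0 -> H1 R G}); split=> [_ [w _ <-]//|v w _ _ _|_ ->].
  by apply/rowP => -[].
by exists 0 => //; exists 0 => //; rewrite mul0mx.
Qed.

End NonTorsionCycle.

Lemma finite_set_pigeonhole (T : choiceType) (F : set T) (s : nat -> T) :
  finite_set F -> (forall k, F (s k)) -> exists k l, (k < l)%N /\ s k = s l.
Proof.
move=> /finite_seqP[r ->] sr; apply: contrapT => s_inj.
have inj : injective s.
  move=> k l kl; apply: contrapT => /eqP; rewrite neq_ltn => /orP[lt|lt]; apply: s_inj.
    by exists k, l.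
  by exists l, k.
have us : uniq (map s (iota 0 (size r).+1)) by rewrite map_inj_uniq// iota_uniq.
have sub : {subset map s (iota 0 (size r).+1) <= r}.
  by move=> _ /mapP[k _ ->]; exact: sr.
by have := uniq_leq_size us sub; rewrite size_map size_iota ltnn.
Qed.

(** * Non-free pairs and the covering of G *)

Section Main.
Variables (R : realType) (G : groupType).
Local Notation LG := (group_vN R G).
Local Notation u := (@vN_group_elt R G).
Local Notation gen := (@gen R G).
Hypothesis torsionfreeG : forall (g : G) (n : nat), g != 1%g -> (0 < n)%N ->
  (g ^+ n)%g != 1%g.
Hypothesis act_injective : forall a : malg G int, a != 0 ->
  injective (@group_ring_act R G a).
Hypothesis betti1_neq0 : l2_betti1 R G != 0%E.

Lemma regular_sub1 (h : G) : h != 1%g -> regular (u h - 1).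
Proof.
move=> h1; apply: in_ZG_regular => //.
  by apply: in_ZGB; [exact: in_ZGu|exact: in_ZG1].
apply/eqP => /(congr1 (fun t : LG => t (delta R 1%g) h)).
rewrite vND vNN l2D l2N -vN_group_elt1 !u_delta eqxx (negbTE h1) subr0 => /eqP.
by rewrite oner_eq0.
Qed.

(** A relation gives a d(g) + b d(f) = 0 modulo boundaries. Its image under [bar_d1] excludes
    [f = 1], and [a], being regular, can be cancelled. *)
Lemma agree_of_not_free (g f : G) : ~ free_from g f -> f != 1%g /\ agree f (gen g).
Proof.
move=> /(@fox_relation R)[a [b [aZ bZ abB a0]]].
have f1 : f != 1%g.
  apply: contra a0 => /eqP f1; have := bar_d1_boundary abB.
  rewrite bar_d1D !bar_d1Z !bar_d1_gen f1 vN_group_elt1 subrr mulr0 addr0.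
  by move=> ->.
split=> //; have freg := regular_sub1 f1.
have areg : regular a.
  by apply: in_ZG_regular => //; apply: contra a0 => /eqP->; rewrite mul0r.
apply: (agree_regular areg).
have bf : agree f (b *: gen f) by apply: agreeZ; exact: agree_gen.
by have := agreeB freg (agree_boundary freg abB) bf; rewrite addrK.
Qed.

Lemma agree_genX (h g : G) n : regular (u h - 1) -> agree h (gen g) ->
  agree h (gen (g ^+ n)%g).
Proof.
move=> hreg hg; elim: n => [|n IHn]; first by rewrite expg0; exact: agree_gen1.
by rewrite expgS; exact: agree_genM.
Qed.

Lemma nontorsion_cycle : exists c : malg G LG, bar_d1 c = 0 /\ ~ torsion c.
Proof.
apply: contrapT => nex; move/eqP: betti1_neq0; apply; apply: betti1_eq0 => c c0.
by apply: contrapT => cT; apply: nex; exists c.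
Qed.

Lemma nontrivial_element : exists g : G, g != 1%g.
Proof.
apply: contrapT => triv; have [c [_]] := nontorsion_cycle; apply.
have all1 g : g = 1%g :> G by apply: contrapT => /eqP g1; apply: triv; exists g.
apply: torsion_boundary; rewrite (monalgE c).
elim: (enum_fset (msupp c)) => [|g s IHs]; first by rewrite big_nil; exact: boundary0.
rewrite big_cons; apply: boundaryD => //; rewrite -scale_gen (all1 g).
exact: boundaryZ (boundary_gen1 R G).
Qed.

(* The subgroups [agree f], for [f] in [F], are equal or intersect trivially, and
   they cover [G] if no [g] works; among the elements [h * g0 ^+ k], two lie in
   the same one. *)
Lemma free_element (F : set G) : finite_set F ->
  exists g : G, g != 1%g /\ forall f, F f -> free_from g f.
Proof.
move=> finF; apply: contrapT => nfree.
have agreeF g : g != 1%g -> exists f, [/\ F f, f != 1%g & agree f (gen g)].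
  move=> g1; apply: contrapT => nf; apply: nfree; exists g; split=> // f Ff.
  apply: contrapT => /agree_of_not_free[f1 fg]; apply: nf; exists f; split=> //.
have [g0 g01] := nontrivial_element; have [f0 [_ f01 f0g0]] := agreeF _ g01.
have f0reg := regular_sub1 f01.
(* If D_f0 were all of G, every cycle would be torsion. So some [h] lies outside, and the coset of
   [h] by the powers of [g0] misses D_f0. *)
have [h nh] : exists h, ~ agree f0 (gen h).
  apply: contrapT => all_agree; have [c [c0]] := nontorsion_cycle; apply.
  apply: (agree_cycle_torsion f0reg) c0 => h; apply: contrapT => nh.
  by apply: all_agree; exists h.
have f0_hg k : ~ agree f0 (gen (h * g0 ^+ k)%g).
  move=> E; apply: nh; rewrite -[h](mulgK (g0 ^+ k)%g).
  by apply: agree_genM => //; apply: agree_genV => //; exact: agree_genX.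
have hg1 k : (h * g0 ^+ k)%g != 1%g.
  by apply/eqP => E; apply: (f0_hg k); rewrite E; exact: agree_gen1.
pose s k := sval (cid (agreeF _ (hg1 k))).
have sP k : [/\ F (s k), s k != 1%g & agree (s k) (gen (h * g0 ^+ k)%g)].
  by rewrite /s; case: (cid _).
have Fs k : F (s k) by have [] := sP k.
have [k [l [kl skl]]] := finite_set_pigeonhole finF Fs.
have [_ f1 fk] := sP k; have [_ _] := sP l; rewrite -skl => fl.
set f := s k in f1 fk fl; have freg := regular_sub1 f1.
pose x := (g0 ^+ (l - k))%g.
have x1 : x != 1%g by apply: torsionfreeG; rewrite ?subn_gt0.
have fx : agree f (gen x).
  have -> : x = ((h * g0 ^+ k)^-1 * (h * g0 ^+ l))%g.
    by rewrite invgM -mulgA mulKg /x -{2}(subnKC (ltnW kl)) expgnDr mulKg.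
  by apply: agree_genM => //; exact: agree_genV.
have xreg := regular_sub1 x1.
(* The non-trivial [x] lies in both D_f0 and D_f, which forces [h * g0 ^+ k] from D_f into D_f0. *)
apply: (f0_hg k); apply: (agree_trans f0reg xreg); first exact: agree_genX.
by apply: (agree_trans xreg freg) fk; exact: agree_sym.
Qed.

End Main.

(** * Free subgroups *)

Section IntegerPowers.
Variable G : groupType.
Local Notation Z := (Algebra.to_multiplicative int).
Implicit Types (g f : G) (m n : int).

Definition expgz g n : G :=
  match n with Posz k => (g ^+ k)%g | Negz k => ((g ^+ k.+1)^-1)%g end.

Lemma expgzS g n : expgz g (n + 1) = (expgz g n * g)%g.
Proof.
case: n => [k|[|k]].
- have -> : (k%:Z + 1 = k.+1%:Z)%R by lia.
  by rewrite /= expgSr.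
- by rewrite /expgz /= expg1 mulVg.
have -> : (Negz k.+1 + 1 = Negz k)%R by lia.
by rewrite /= [in RHS]expgS invgM mulgVK.
Qed.

Lemma expgzD g m n : expgz g (m + n) = (expgz g m * expgz g n)%g.
Proof.
have expgzDn (m' : int) (k : nat) : expgz g (m' + k%:Z) = (expgz g m' * expgz g k%:Z)%g.
  elim: k => [|k IHk]; first by rewrite addr0 mulg1.
  have -> : (k.+1%:Z = k%:Z + 1)%R by lia.
  by rewrite addrA !expgzS IHk mulgA.
case: n => k; first exact: expgzDn.
rewrite NegzE; apply: (mulIg (expgz g k.+1%:Z)).
by rewrite -expgzDn subrK -mulgA -expgzDn addNr mulg1.
Qed.
Definition zpower g : Z -> G := expgz g.
HB.instance Definition _ g :=
  monoid.isMultiplicative.Build Z G (zpower g) (expgzD g).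

Lemma generated_expgz g x : generated [set g] x -> exists n, expgz g n = x.
Proof.
apply: (@generated_ind _ _ (fun x => exists n, expgz g n = x)).
- by exists 0; exact: expg0.
- move=> _ _ [m <-] [n <-]; exists (m - n).
  apply: (mulIg (expgz g n)); rewrite mulgVK -expgzD.
  by rewrite subrK.
- by move=> _ ->; exists 1; exact: expg1.
Qed.

Lemma expgz_generated g n : expgz g n \in in_generated [set g].
Proof.
have gX k : (g ^+ k)%g \in in_generated [set g].
  elim: k => [|k IHk]; first by rewrite expg0; exact: (generated_group_closed _).1.
  rewrite expgS; apply: (group_closedM (generated_group_closed _)) => //.
  exact: mem_generated.
case: n => k; first exact: gX.
exact: (group_closedV (generated_group_closed _)) (gX _).
Qed.

Hypothesis torsionfreeG : forall (g : G) (n : nat), g != 1%g -> (0 < n)%N ->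
  (g ^+ n)%g != 1%g.

Lemma expgz_inj g : g != 1%g -> injective (expgz g).
Proof.
move=> g1 m n mn; apply/eqP; rewrite -subr_eq0; apply/eqP.
have: expgz g (m - n) = 1%g.
  by apply: (mulIg (expgz g n)); rewrite mul1g -expgzD subrK.
case: (m - n) => [[|k]|k] //= /eqP; first by rewrite (negbTE (torsionfreeG _ _)).
by rewrite invg_eq1 (negbTE (torsionfreeG _ _)).
Qed.

Section Logarithm.
Variables (g : G) (g1 : g != 1%g).

Definition cyclic_elt (n : Z) : subgroup_gen [set g] :=
  SubgroupGen (expgz_generated g n).

Lemma cyclic_log_ex (x : subgroup_gen [set g]) : exists n : Z, expgz g n = val x.
Proof. by apply: generated_expgz; have /set_mem := valP x. Qed.

Definition cyclic_log (x : subgroup_gen [set g]) : Z := sval (cid (cyclic_log_ex x)).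

Lemma cyclic_logE x : expgz g (cyclic_log x) = val x.
Proof. by rewrite /cyclic_log; case: (cid _). Qed.

Lemma cyclic_logM : {morph cyclic_log : x y / (x * y)%g}.
Proof.
by move=> x y; apply: (expgz_inj g1); rewrite [RHS]expgzD !cyclic_logE.
Qed.
HB.instance Definition _ :=
  monoid.isMultiplicative.Build (subgroup_gen [set g]) Z cyclic_log cyclic_logM.

Lemma cyclic_eltK : cancel cyclic_elt cyclic_log.
Proof. by move=> n; apply: (expgz_inj g1); rewrite cyclic_logE. Qed.

End Logarithm.
End IntegerPowers.

Definition letter_map (A B A' B' : Type) (h : A -> A') (k : B -> B') (x : A + B) :
  A' + B' := match x with inl a => inl (h a) | inr b => inr (k b) end.

Lemma fp_eq_map (A B A' B' : groupType) (h : {multiplicative A -> A'})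
    (k : {multiplicative B -> B'}) v w :
  fp_eq v w -> fp_eq (map (letter_map h k) v) (map (letter_map h k) w).
Proof.
elim=> {v w} /=.
- by move=> w; exact: fp_eq_refl.
- by move=> v w _; exact: fp_eq_sym.
- by move=> u v w _ uv _; exact: fp_eq_trans.
- by move=> v v' w w' _ vv' _ ww'; rewrite !map_cat; exact: fp_eq_cat.
- by rewrite multiplicative1; exact: fp_eq_inl1.
- by rewrite multiplicative1; exact: fp_eq_inr1.
- by move=> a a'; rewrite gmulfM; exact: fp_eq_inlM.
- by move=> b b'; rewrite gmulfM; exact: fp_eq_inrM.
Qed.

Section FreeSubgroup.
Variable G : groupType.
Hypothesis torsionfreeG : forall (g : G) (n : nat), g != 1%g -> (0 < n)%N ->
  (g ^+ n)%g != 1%g.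

Lemma F2_of_free_from (g f : G) : g != 1%g -> f != 1%g -> free_from g f ->
  exists phi : {multiplicative F2 -> G}, injective phi.
Proof.
move=> g1 f1 /free_fromP gf_inj.
pose phi : F2 -> G := fp_lift (zpower g) (zpower f).
pose phi_mul := monoid.isMultiplicative.Build F2 G phi (fp_liftM _ _).
pose Phi : {multiplicative F2 -> G} := HB.pack phi phi_mul.
exists Phi; rewrite /=.
(* Torsion-freeness identifies the infinite cyclic factors with <g> and <f>; an equality in their
   free product is carried back along [down]. *)
pose up := letter_map (cyclic_elt g) (cyclic_elt f).
pose down := letter_map (cyclic_log (g := g)) (cyclic_log (g := f)).
have phiE w : phi (\pi_F2 w) = word_val (map up w).
  rewrite /phi fp_lift_pi /fp_word_eval /word_val big_map.
  by apply: eq_bigr => -[a|b].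
elim/quotW => v; elim/quotW => w; rewrite !phiE -!canonical_hom_pi.
move=> /val_inj/gf_inj/fp_piP/asboolP vw; apply/fp_piP/asboolP.
have downK u : map down (map up u) = u.
  rewrite -map_comp -[RHS]map_id; apply: eq_map => -[a|b] /=.
    by rewrite cyclic_eltK.
  by rewrite cyclic_eltK.
by rewrite -[v]downK -[w]downK; exact: fp_eq_map.
Qed.

End FreeSubgroup.

Theorem corollary4p4 (R : realType) (G : groupType)
    (countableG : countable [set: G])
    (torsionfreeG : forall (g : G) (n : nat), g != 1%g -> (0 < n)%N ->
                    (g ^+ n)%g != 1%g)
    (act_injective : forall a : malg G int, a != 0 ->
                     injective (@group_ring_act R G a))
    (betti1_neq0 : l2_betti1 R G != 0%E) :
  (forall F : set G, finite_set F ->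
     exists g : G, g != 1%g /\ forall f : G, F f -> free_from g f) /\
  (exists phi : {multiplicative F2 -> G}, injective phi).
Proof.
have free F := free_element torsionfreeG act_injective betti1_neq0 (F := F).
(* An element free from a single non-trivial [f] generates with it a free group of rank 2. *)
split=> //; have [f f1] := nontrivial_element betti1_neq0.
have [g [g1 gf]] := free [set f] (finite_set1 f).
exact: (F2_of_free_from torsionfreeG g1 f1 (gf f erefl)).
Qed.
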